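(* Consider a finite sequence $\{\mathbf{X}_j\}$ of independent, random, self-adjoint matrices with dimension $n$, and let $1\le k\le n$ be an integer. (i) Let $\{\mathbf{A}_j\}$ be a sequence of (fixed) self-adjoint matrices with dimension $n$ and let $g:(0,\infty)\to[0,\infty)$ be a function such that, for every $j$ and every $\theta>0$, $$\mathbb{E}\,e^{\theta\mathbf{X}_j}\preceq e^{g(\theta)\mathbf{A}_j}.$$ Then, for all $t\in\mathbb{R}$, $$\mathbb{P}\Big\{\lambda_k\Big(\sum_j\mathbf{X}_j\Big)\ge t\Big\}\le\inf_{\theta>0}\ \min_{\mathbf{V}\in\mathbb{V}^n_{n-k+1}}\Big[e^{-\theta t}\cdot\operatorname{tr}\exp\Big\{g(\theta)\sum_j\mathbf{V}^*\mathbf{A}_j\mathbf{V}\Big\}\Big].$$ (ii) Let $\{\mathbf{A}_j:\mathbb{V}^n_{n-k+1}\to\mathbb{M}^{n-k+1}_{\mathrm{sa}}\}$ be a sequence of functions and let $g:(0,\infty)\to[0,\infty)$ be a function such that, for every $j$, every $\theta>0$ and every $\mathbf{V}\in\mathbb{V}^n_{n-k+1}$, $$\mathbb{E}\,e^{\theta\mathbf{V}^*\mathbf{X}_j\mathbf{V}}\preceq e^{g(\theta)\mathbf{A}_j(\mathbf{V})}.$$ Then, for all $t\in\mathbb{R}$, $$\mathbb{P}\Big\{\lambda_k\Big(\sum_j\mathbf{X}_j\Big)\ge t\Big\}\le\inf_{\theta>0}\ \inf_{\mathbf{V}\in\mathbb{V}^n_{n-k+1}}\Big[e^{-\theta t}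\cdot\operatorname{tr}\exp\Big\{g(\theta)\sum_j\mathbf{A}_j(\mathbf{V})\Big\}\Big].$$
   Context: Matrices are complex. $\mathbb{M}^{m}_{\mathrm{sa}}$ is the set of self-adjoint matrices of dimension $m$. For $1\le d\le n$, $\mathbb{V}^n_d=\{\mathbf{V}\in\mathbb{C}^{n\times d}:\mathbf{V}^*\mathbf{V}=\mathbf{I}\}$ is the complex Stiefel manifold. Eigenvalues of a self-adjoint matrix are listed in weakly decreasing order $\lambda_1\ge\lambda_2\ge\cdots$. $\mathbf{A}\preceq\mathbf{B}$ means that $\mathbf{B}-\mathbf{A}$ is positive semidefinite. *)

(* Defs.v *)
From HB Require Import structures.
From mathcomp Require Import all_boot all_order all_algebra.
From mathcomp Require Import all_classical all_reals all_analysis.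
From mathcomp Require Export sesquilinear spectral.
From mathcomp Require Export complex.

Set Implicit Arguments.
Unset Strict Implicit.
Unset Printing Implicit Defensive.

Import Order.TTheory GRing.Theory Num.Theory.
Import numFieldNormedType.Exports.

Local Open Scope classical_set_scope.
Local Open Scope ring_scope.
Local Open Scope complex_scope.
Local Open Scope sesquilinear_scope.

Section matrices.
Context {R : realType}.

(* V^t* is the conjugate transpose, so this is V^* V = I. *)
Definition stiefel (n d : nat) : set 'M[R[i]]_(n, d) :=
  [set V | V^t* *m V = 1%:M].

(* The order of R[i] makes 0 <= z mean that z is real and nonnegative. *)
Definition psdmx (n : nat) (A : 'M[R[i]]_n) : Prop :=
  A \is hermsymmx /\ forall x : 'cV[R[i]]_n, 0 <= (x^t* *m A *m x) 0 0.

Definition loewner_le (n : nat) (A B : 'M[R[i]]_n) : Prop := psdmx (B - A).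

(* exp A = \sum_k A^k / k!, the limit being taken on the real and imaginary
   parts of each entry. *)
Definition expmx_psum (n : nat) (A : 'M[R[i]]_n) (N : nat) : 'M[R[i]]_n :=
  \sum_(k < N) (k`!%:R^-1 : R[i]) *: A ^+ k.

Definition expmx (n : nat) (A : 'M[R[i]]_n) : 'M[R[i]]_n :=
  \matrix_(i, j)
    (limn (fun N => complex.Re (expmx_psum A N i j))
     +i* limn (fun N => complex.Im (expmx_psum A N i j))).

(* The roots of the characteristic polynomial, repeated according to
   multiplicity and listed in weakly decreasing order; they are real when A is
   self-adjoint, the only case in which this is used. *)
Definition eigvals (n : nat) (A : 'M[R[i]]_n) : seq R :=
  sort (fun x y : R => y <= x)
    [seq complex.Re z | z <- sval (closed_field_poly_normal (char_poly A))].

(* k is counted from 1: lambda 1 A is the largest eigenvalue. *)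
Definition lambda (n k : nat) (A : 'M[R[i]]_n) : R := nth 0 (eigvals A) k.-1.

(* The Borel sigma-algebra of C^(n x n), generated by the real and imaginary
   parts of the entries. *)
Definition borel_mx (n : nat) : set (set 'M[R[i]]_n) :=
  <<s [set A | exists (i j : 'I_n) (B : set R), measurable B /\
        (A = [set M : 'M[R[i]]_n | B (complex.Re (M i j))] \/
         A = [set M : 'M[R[i]]_n | B (complex.Im (M i j))])] >>.

End matrices.

Definition is_minimum {R : realType} (E : set R) (m : R) : Prop :=
  E m /\ lbound E m.

Section random_matrices.
Context {R : realType} {d : measure_display} {T : measurableType d}.
Context (P : probability T R).

Definition random_mx (n : nat) (X : T -> 'M[R[i]]_n) : Prop :=
  forall B, borel_mx B -> measurable (X @^-1` B).

Definition independent_mx (n N : nat) (X : 'I_N -> T -> 'M[R[i]]_n) : Prop :=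
  forall (J : {set 'I_N}) (B : 'I_N -> set 'M[R[i]]_n),
    (forall j, borel_mx (B j)) ->
    P (\bigcap_(j in [set` J]) (X j @^-1` B j)) =
    (\prod_(j in J) P (X j @^-1` B j))%E.

Definition integrable_mx (n : nat) (Y : T -> 'M[R[i]]_n) : Prop :=
  forall i j,
    P.-integrable [set: T] (EFin \o (fun w => complex.Re (Y w i j))) /\
    P.-integrable [set: T] (EFin \o (fun w => complex.Im (Y w i j))).

(* Meaningful only when integrable_mx Y holds. *)
Definition expectation_mx (n : nat) (Y : T -> 'M[R[i]]_n) : 'M[R[i]]_n :=
  \matrix_(i, j)
    (fine ('E_P[fun w => complex.Re (Y w i j)])
     +i* fine ('E_P[fun w => complex.Im (Y w i j)])).

End random_matrices.

(* Main.v *)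
Require Import Defs.
From HB Require Import structures.
From mathcomp Require Import all_boot all_order all_algebra.
From mathcomp Require Import all_classical all_reals all_analysis.
From mathcomp Require Import measurable_realfun.
From mathcomp Require Import sesquilinear spectral complex.
From mathcomp Require Import fingroup perm.
From mathcomp Require Import ring lra zify.

Set Implicit Arguments.
Unset Strict Implicit.
Unset Printing Implicit Defensive.

Import Order.TTheory GRing.Theory Num.Theory.
Import numFieldNormedType.Exports.

Local Open Scope classical_set_scope.
Local Open Scope ring_scope.
Local Open Scope complex_scope.
Local Open Scope sesquilinear_scope.

(** The idea is to bound the upper tail of [lambda k] by the trace of a matrix
    exponential (a Courant-Fischer argument and Markov's inequality), and to
    bound the expectation of that trace one independent summand at a time by
      E e^X <= e^B  ==>  E tr e^(H + X) <= tr e^(H + B),          (Lieb-Tropp)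
    which is Lieb's concavity theorem combined with Jensen's inequality.

    For (Lieb-Tropp), put Y = e^(H + X), so that tr Y H = D(Y; e^X) with D the
    quantum relative entropy D(Y; A) = tr Y (log Y - log A).  Riemann sums for
    the logarithm bound D from below by functionals (Y, A) |-> tr C Y - tr G A
    with G psd, and this bound is sharp up to [eps] at any given point.
    Averaging the bound that is sharp at (E Y, e^B) gives
    tr (E Y) H >= D(E Y; e^B) - eps, and Gibbs' variational principle turns this
    into tr E Y <= tr e^(H + B) + eps.

    In (i) the minimum over V is attained at the eigenvectors of the n - k + 1
    smallest eigenvalues of g(theta) \sum_j A_j, by Poincare separation.
    Compressing to their span is replaced by subtracting c times the projection
    on the other k - 1 eigenvectors and letting c tend to infinity, which keeps
    the problem in dimension n, where the hypothesis lives. *)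

(** * Spectral calculus *)

Section complex_parts.
Context {R : realType}.
Implicit Types (z w : R[i]) (a : R).

Lemma ReD z w : complex.Re (z + w) = complex.Re z + complex.Re w.
Proof. by case: z => a b; case: w. Qed.

Lemma ImD z w : complex.Im (z + w) = complex.Im z + complex.Im w.
Proof. by case: z => a b; case: w. Qed.

Lemma ReN z : complex.Re (- z) = - complex.Re z.
Proof. by case: z. Qed.

Lemma ReM z w : complex.Re (z * w) =
  complex.Re z * complex.Re w - complex.Im z * complex.Im w.
Proof. by case: z => a b; case: w. Qed.

Lemma ImM z w : complex.Im (z * w) =
  complex.Re z * complex.Im w + complex.Im z * complex.Re w.
Proof. by case: z => a b; case: w. Qed.

Lemma Re_realM a z : complex.Re (a%:C * z) = a * complex.Re z.
Proof. by rewrite ReM mul0r subr0. Qed.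

Lemma Im_realM a z : complex.Im (a%:C * z) = a * complex.Im z.
Proof. by rewrite ImM mul0r addr0. Qed.

Lemma Re_sum (I : Type) (s : seq I) (Q : pred I) (F : I -> R[i]) :
  complex.Re (\sum_(i <- s | Q i) F i) = \sum_(i <- s | Q i) complex.Re (F i).
Proof. by apply: (big_morph _ ReD). Qed.

Lemma Im_sum (I : Type) (s : seq I) (Q : pred I) (F : I -> R[i]) :
  complex.Im (\sum_(i <- s | Q i) F i) = \sum_(i <- s | Q i) complex.Im (F i).
Proof. by apply: (big_morph _ ImD). Qed.

Lemma conjC_conjc z : Num.conj z = z^*%C.
Proof. by []. Qed.

Lemma conjC_real a : Num.conj a%:C = a%:C.
Proof. by rewrite conjC_conjc /= oppr0. Qed.

Lemma real_complexD a b : (a + b)%:C = a%:C + b%:C :> R[i].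
Proof. by rewrite rmorphD. Qed.

Definition nsq z : R := complex.Re z ^+ 2 + complex.Im z ^+ 2.

Lemma nsq_ge0 z : 0 <= nsq z.
Proof. by rewrite addr_ge0 // sqr_ge0. Qed.

Lemma nsq_eq0 z : (nsq z == 0) = (z == 0).
Proof.
rewrite /nsq paddr_eq0 ?sqr_ge0 // !sqrf_eq0.
by case: z => a b; rewrite eq_complex.
Qed.

Lemma mulcJ z : z * Num.conj z = (nsq z)%:C.
Proof.
rewrite conjC_conjc; case: z => a b /=; apply/eqP.
by rewrite eq_complex /nsq /=; apply/andP; split; apply/eqP; ring.
Qed.

Lemma nsqC z : nsq (Num.conj z) = nsq z.
Proof. by rewrite conjC_conjc; case: z => a b; rewrite /nsq /= sqrrN. Qed.

End complex_parts.
Lemma cvgn_sum (R : realType) (I : finType) (f : I -> nat -> R) (l : I -> R) :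
  (forall i, f i @ \oo --> l i) ->
  (fun N => \sum_i f i N) @ \oo --> \sum_i l i.
Proof.
by move=> fl; apply: cvg_big => [|i _]; [exact: add_continuous|exact: fl].
Qed.

(** * Self-adjoint matrices and their functional calculus *)

Section adjoint.
Context {R : realType}.

Lemma trmxC_mul (m n p : nat) (A : 'M[R[i]]_(m, n)) (B : 'M[R[i]]_(n, p)) :
  (A *m B)^t* = B^t* *m A^t*.
Proof. by rewrite trmx_mul map_mxM. Qed.

Lemma trmxCD (m n : nat) (A B : 'M[R[i]]_(m, n)) : (A + B)^t* = A^t* + B^t*.
Proof. by rewrite linearD /= map_mxD. Qed.

Lemma trmxCZ (m n : nat) (a : R) (A : 'M[R[i]]_(m, n)) :
  (a%:C *: A)^t* = a%:C *: A^t*.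
Proof. by rewrite linearZ /= map_mxZ; congr (_ *: _); exact: conjC_real. Qed.

Lemma trmxC1 (n : nat) : (1%:M : 'M[R[i]]_n)^t* = 1%:M.
Proof. by rewrite trmx1 map_mx1. Qed.

Lemma hermsymmxP (n : nat) (A : 'M[R[i]]_n) :
  reflect (A = A^t*) (A \is hermsymmx).
Proof.
by apply: (iffP (is_hermitianmxP _ _ _)); rewrite expr0 scale1r.
Qed.

Lemma hermsymmx0 (n : nat) : (0 : 'M[R[i]]_n) \is hermsymmx.
Proof. by apply/hermsymmxP; rewrite trmx0 map_mx0. Qed.

Lemma hermsymmxD (n : nat) (A B : 'M[R[i]]_n) :
  A \is hermsymmx -> B \is hermsymmx -> A + B \is hermsymmx.
Proof.
move=> /hermsymmxP hA /hermsymmxP hB; apply/hermsymmxP.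
by rewrite trmxCD -hA -hB.
Qed.

Lemma hermsymmxZ (n : nat) (a : R) (A : 'M[R[i]]_n) :
  A \is hermsymmx -> a%:C *: A \is hermsymmx.
Proof. by move=> /hermsymmxP hA; apply/hermsymmxP; rewrite trmxCZ -hA. Qed.

Lemma hermsymmx_sum (I : Type) (s : seq I) (Q : pred I) (n : nat)
    (A : I -> 'M[R[i]]_n) :
  (forall i, Q i -> A i \is hermsymmx) ->
  \sum_(i <- s | Q i) A i \is hermsymmx.
Proof.
move=> hA; apply: (big_ind (fun M => M \is hermsymmx) (hermsymmx0 n) _ hA).
by move=> ? ?; exact: hermsymmxD.
Qed.

Lemma hermsymmx_conj (m n : nat) (V : 'M[R[i]]_(n, m)) (A : 'M[R[i]]_n) :
  A \is hermsymmx -> V^t* *m A *m V \is hermsymmx.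
Proof.
move=> /hermsymmxP hA; apply/hermsymmxP.
by rewrite !trmxC_mul trmxCK -hA mulmxA.
Qed.

(** The columns of [U^t*] are the eigenvectors. For a fixed unitary [U], functions of the matrix act
    on [a] alone, so matrix identities become scalar ones. *)
Definition specmx (n : nat) (U : 'M[R[i]]_n) (a : 'I_n -> R) : 'M[R[i]]_n :=
  U^t* *m diag_mx (\row_i (a i)%:C) *m U.

Section specmx_theory.
Variables (n : nat) (U : 'M[R[i]]_n).
Hypothesis U_unitary : U \is unitarymx.

Lemma unitarymx_mulVmx : U^t* *m U = 1%:M.
Proof. by apply: mulmx1C; apply/unitarymxP. Qed.

Lemma specmxE (a : 'I_n -> R) i j :
  specmx U a i j = \sum_l (a l)%:C * (Num.conj (U l i) * U l j).
Proof.
rewrite /specmx mul_mx_diag !mxE; apply: eq_bigr => l _.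
by rewrite !mxE mulrCA mulrA.
Qed.

Lemma eq_specmx (a b : 'I_n -> R) : a =1 b -> specmx U a = specmx U b.
Proof. by move=> /funext ->. Qed.

Lemma specmx_herm (a : 'I_n -> R) : specmx U a \is hermsymmx.
Proof.
apply: hermsymmx_conj; apply/hermsymmxP.
rewrite tr_diag_mx map_diag_mx; congr diag_mx.
by apply/rowP => i; rewrite !mxE; apply: esym; exact: conjC_real.
Qed.

Lemma specmx1 : specmx U (fun=> 1) = 1%:M.
Proof.
rewrite /specmx (_ : (\row__ _) = const_mx 1); last first.
  by apply/rowP => i; rewrite !mxE.
by rewrite diag_const_mx mulmx1 unitarymx_mulVmx.
Qed.

Lemma specmxD (a b : 'I_n -> R) :
  specmx U a + specmx U b = specmx U (fun i => a i + b i).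
Proof.
apply/matrixP => i j; rewrite [LHS]mxE; apply: etrans (esym (specmxE _ i j)).
apply: (etrans (congr2 +%R (specmxE a i j) (specmxE b i j))).
rewrite -big_split; apply: eq_bigr => l _.
by rewrite real_complexD mulrDl.
Qed.

Lemma specmxZ (c : R) (a : 'I_n -> R) :
  c%:C *: specmx U a = specmx U (fun i => c * a i).
Proof.
apply/matrixP => i j; rewrite [LHS]mxE; apply: etrans (esym (specmxE _ i j)).
apply: (etrans (congr1 _ (specmxE a i j))); rewrite mulr_sumr.
apply: eq_bigr => l _.
by rewrite rmorphM mulrA.
Qed.

Lemma specmxM (a b : 'I_n -> R) :
  specmx U a *m specmx U b = specmx U (fun i => a i * b i).
Proof.
rewrite /specmx.
rewrite -!mulmxA [U *m _]mulmxA (unitarymxP U_unitary) mul1mx.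
congr (_ *m _); rewrite mulmxA.
congr (_ *m _); apply/matrixP => i j; rewrite mul_diag_mx !mxE.
by case: eqP => [->|_]; rewrite ?mulr1n ?mulr0n ?mulr0 // rmorphM.
Qed.

Lemma specmxX (a : 'I_n -> R) k : specmx U a ^+ k = specmx U (fun i => a i ^+ k).
Proof.
elim: k => [|k IHk]; first by rewrite expr0 -[RHS]/(specmx U (fun=> 1)) specmx1.
by rewrite exprS IHk [LHS]specmxM; apply: eq_specmx => i; rewrite exprS.
Qed.

Lemma mxtrace_specmx (a : 'I_n -> R) : \tr (specmx U a) = (\sum_i a i)%:C.
Proof.
rewrite /specmx -mulmxA mxtrace_mulC mulmxtVK // mxtrace_diag rmorph_sum /=.
by apply: eq_bigr => i _; rewrite mxE.
Qed.

Lemma expmx_psum_specmx (a : 'I_n -> R) N :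
  expmx_psum (specmx U a) N =
  specmx U (fun i => series (exp_coeff (a i)) N).
Proof.
apply/matrixP => i j; rewrite /expmx_psum summxE specmxE.
transitivity (\sum_(k < N) \sum_l
    (exp_coeff (a l) k)%:C * (Num.conj (U l i) * U l j)).
  apply: eq_bigr => k _; rewrite mxE specmxX specmxE mulr_sumr.
  apply: eq_bigr => l _; rewrite mulrA; congr (_ * _).
  by rewrite /exp_coeff rmorphM mulrC fmorphV rmorph_nat.
rewrite exchange_big; apply: eq_bigr => l _.
rewrite -mulr_suml; congr (_ * _).
by rewrite /series /= big_mkord rmorph_sum.
Qed.

Lemma cvg_Re_expmx_psum (a : 'I_n -> R) i j :
  (fun N => complex.Re (expmx_psum (specmx U a) N i j)) @ \oo -->
  complex.Re (specmx U (fun i => expR (a i)) i j).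
Proof.
rewrite specmxE Re_sum; under eq_fun do rewrite expmx_psum_specmx specmxE Re_sum.
apply: cvgn_sum => l; rewrite Re_realM; under eq_fun do rewrite Re_realM.
by apply: cvgMr_tmp; exact: is_cvg_series_exp_coeff.
Qed.

Lemma cvg_Im_expmx_psum (a : 'I_n -> R) i j :
  (fun N => complex.Im (expmx_psum (specmx U a) N i j)) @ \oo -->
  complex.Im (specmx U (fun i => expR (a i)) i j).
Proof.
rewrite specmxE Im_sum; under eq_fun do rewrite expmx_psum_specmx specmxE Im_sum.
apply: cvgn_sum => l; rewrite Im_realM; under eq_fun do rewrite Im_realM.
by apply: cvgMr_tmp; exact: is_cvg_series_exp_coeff.
Qed.

Lemma expmx_specmx (a : 'I_n -> R) :
  expmx (specmx U a) = specmx U (fun i => expR (a i)).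
Proof.
apply/matrixP => i j; rewrite mxE.
rewrite (cvg_lim _ (@cvg_Re_expmx_psum a i j)) //.
rewrite (cvg_lim _ (@cvg_Im_expmx_psum a i j)) //.
by case: (specmx _ _ i j).
Qed.

End specmx_theory.
End adjoint.

(** * The spectral theorem with ordered eigenvalues *)

Section spectral_theorem.
Context {R : realType}.

(** [X - A] is conjugate to [X - D] over the polynomial ring, and the determinants of [U^t*] and [U]
    cancel. *)
Lemma char_poly_specmx (n : nat) (U : 'M[R[i]]_n) (a : 'I_n -> R) :
  U \is unitarymx ->
  char_poly (specmx U a) = \prod_(z <- [seq (a i)%:C | i : 'I_n]) ('X - z%:P).
Proof.
move=> uU; set D := diag_mx (\row_i (a i)%:C).
have -> : char_poly (specmx U a) = char_poly D.
  rewrite /char_poly.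
  have -> : char_poly_mx (specmx U a) =
      map_mx polyC (U^t*) *m char_poly_mx D *m map_mx polyC U.
    rewrite /char_poly_mx mulmxBr mulmxBl -!map_mxM; congr (_ - _).
    rewrite scalar_mxC -mulmxA -map_mxM unitarymx_mulVmx // map_mx1.
    by rewrite mulmx1.
  rewrite !det_mulmx mulrAC -det_mulmx -map_mxM unitarymx_mulVmx //.
  by rewrite map_mx1 det1 mul1r.
rewrite char_poly_trig ?diag_mx_is_trig // big_map big_enum /=.
by apply: eq_bigr => i _; rewrite !mxE eqxx mulr1n.
Qed.

(** Both lists come from the roots of one monic polynomial, so they agree up to a permutation, which
    sorting removes. *)
Lemma eigvals_specmx (n : nat) (U : 'M[R[i]]_n) (a : 'I_n -> R) :
  U \is unitarymx ->
  eigvals (specmx U a) = sort (fun x y : R => y <= x) [seq a i | i : 'I_n].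
Proof.
move=> uU; rewrite /eigvals; case: closed_field_poly_normal => r /= hr.
apply/perm_sortP.
- by move=> x y; apply: le_total.
- by move=> x y z xy yz; exact: le_trans yz xy.
- by move=> x y /andP[xy yx]; apply/eqP; rewrite eq_le xy yx.
rewrite -[X in perm_eq _ X](_ :
    [seq complex.Re z | z <- [seq (a i)%:C | i : 'I_n]] = _); last first.
  by rewrite -map_comp.
apply: perm_map; apply: prod_XsubC_eq.
rewrite -(char_poly_specmx a uU) hr.
by rewrite (monicP (char_poly_monic _)) scale1r.
Qed.

(** The spectral theorem yields an eigenbasis in some order. Permuting the rows of the unitary
    matrix matches row [i], counted from 0, with [lambda i.+1]. *)
Lemma spectral_decomposition (n : nat) (A : 'M[R[i]]_n) : A \is hermsymmx ->
  exists2 U : 'M[R[i]]_n, U \is unitarymx &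
    A = specmx U (fun i => lambda i.+1 A).
Proof.
move=> hA.
have [V uV [a Aa]] : exists2 V : 'M[R[i]]_n, V \is unitarymx &
    exists a, A = specmx V a.
  exists (spectralmx A); first exact: spectral_unitarymx.
  exists (fun i => complex.Re (spectral_diag A 0 i)).
  rewrite {1}(orthomx_spectralP (hermitian_normalmx hA)).
  rewrite (invmx_unitary (spectral_unitarymx A)) /specmx; do 2!congr (_ *m _); congr diag_mx.
  apply/rowP => i; rewrite mxE RRe_real //.
  by move/mxOverP: (hermitian_spectral_diag_real hA); apply.
have [p hp] : exists p : {perm 'I_n}, eigvals A = [tuple a (p i) | i < n].
  have /tuple_permP[p hp] : perm_eq (eigvals A) [tuple a i | i < n].
    by rewrite Aa eigvals_specmx // perm_sort.
  by exists p; rewrite hp; apply: eq_map => i; rewrite tnth_mktuple.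
have lamE (i : 'I_n) : lambda i.+1 A = a (p i).
  by rewrite /lambda hp /= (nth_map i) ?size_enum_ord // nth_ord_enum.
exists (row_perm p V).
  apply/unitarymxP; rewrite row_permE trmxC_mul mulmxA -(mulmxA _ V).
  rewrite (unitarymxP uV) mulmx1 tr_perm_mx map_perm_mx -perm_mxM.
  by rewrite mulgV perm_mx1.
rewrite {1}Aa; apply/matrixP => i j; rewrite !specmxE.
by rewrite (reindex_perm p); apply: eq_bigr => l _; rewrite lamE !mxE.
Qed.

Lemma lambda_le (n : nat) (A : 'M[R[i]]_n) (i j : nat) : A \is hermsymmx ->
  (i <= j)%N -> (j < n)%N -> lambda j.+1 A <= lambda i.+1 A.
Proof.
move=> hA ij jn; have [U uU AU] := spectral_decomposition hA.
have sz : size (eigvals A) = n.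
  by rewrite AU eigvals_specmx // size_sort size_map size_enum_ord.
apply: (@sorted_leq_nth _ (fun x y : R => y <= x)) => //.
- by move=> x y z xy yz; exact: le_trans yz xy.
- by apply: sort_sorted => x y; exact: le_total.
- by rewrite inE sz (leq_ltn_trans ij).
- by rewrite inE sz.
Qed.

Lemma hermsymmx_expmx (n : nat) (A : 'M[R[i]]_n) :
  A \is hermsymmx -> expmx A \is hermsymmx.
Proof.
by case/spectral_decomposition => U uU ->; rewrite expmx_specmx ?specmx_herm.
Qed.

Lemma spectral_expmx (n : nat) (A : 'M[R[i]]_n) : A \is hermsymmx ->
  exists (U : 'M[R[i]]_n) (a : 'I_n -> R), [/\ U \is unitarymx,
    A = specmx U a & expmx A = specmx U (fun i => expR (a i))].
Proof.
case/spectral_decomposition => U uU AU; exists U, (fun i => lambda i.+1 A).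
by split; [exact: uU|exact: AU|rewrite {1}AU; exact: expmx_specmx].
Qed.

Lemma trexpE (n : nat) (A : 'M[R[i]]_n) : A \is hermsymmx ->
  complex.Re (\tr (expmx A)) = \sum_(i < n) expR (lambda i.+1 A).
Proof.
case/spectral_decomposition => U uU {1}->.
by rewrite expmx_specmx // mxtrace_specmx.
Qed.

End spectral_theorem.

(** * Traces and quadratic forms expressed in two eigenbases *)

Section trace_forms.
Context {R : realType}.

(** By cyclicity the trace depends only on [E = U F W^t*], that is, on [F] written in the two
    eigenbases. Trace inequalities thereby reduce to scalar inequalities with weights
    [nsq (E i j) >= 0]. *)
Lemma tr_specmx2 (n m : nat) (U : 'M[R[i]]_n) (W : 'M[R[i]]_m)
    (a : 'I_n -> R) (b : 'I_m -> R) (F : 'M[R[i]]_(n, m)) :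
  \tr (specmx U a *m F *m specmx W b *m F^t*) =
  (\sum_i \sum_j a i * b j * nsq ((U *m F *m W^t*) i j))%:C.
Proof.
set E := U *m F *m W^t*.
have -> : \tr (specmx U a *m F *m specmx W b *m F^t*) =
    \tr (diag_mx (\row_i (a i)%:C) *m E *m diag_mx (\row_i (b i)%:C) *m E^t*).
  rewrite /specmx /E !trmxC_mul trmxCK -4!(mulmxA (U^t*)) mxtrace_mulC.
  by rewrite !mulmxA.
rewrite /mxtrace rmorph_sum; apply: eq_bigr => i _ /=.
rewrite mxE rmorph_sum; apply: eq_bigr => j _ /=.
rewrite mul_mx_diag mul_diag_mx !rmorphM /= -[in RHS]mulcJ; clearbody E.
by rewrite !mxE; ring.
Qed.

Lemma tr_specmx_mulmx (n m : nat) (U : 'M[R[i]]_n) (W : 'M[R[i]]_m)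
    (a : 'I_n -> R) (F : 'M[R[i]]_(n, m)) : W \is unitarymx ->
  \tr (specmx U a *m (F *m F^t*)) =
  (\sum_i \sum_j a i * nsq ((U *m F *m W^t*) i j))%:C.
Proof.
move=> uW; have := tr_specmx2 U W a (fun=> 1) F.
rewrite specmx1 // mulmx1 -mulmxA => ->.
by congr (_%:C); do 2!apply: eq_bigr => ? _; rewrite mulr1.
Qed.

Lemma tr_mulmx_specmx (n m : nat) (U : 'M[R[i]]_n) (W : 'M[R[i]]_m)
    (b : 'I_m -> R) (F : 'M[R[i]]_(n, m)) : U \is unitarymx ->
  \tr (F^t* *m F *m specmx W b) =
  (\sum_i \sum_j b j * nsq ((U *m F *m W^t*) i j))%:C.
Proof.
move=> uU; have := tr_specmx2 U W (fun=> 1) b F.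
rewrite specmx1 // mul1mx mxtrace_mulC mulmxA => ->.
by congr (_%:C); do 2!apply: eq_bigr => ? _; rewrite mul1r.
Qed.

Lemma tr_specmxM (n : nat) (U W : 'M[R[i]]_n) (a b : 'I_n -> R) :
  \tr (specmx U a *m specmx W b) =
  (\sum_i \sum_j a i * b j * nsq ((U *m W^t*) i j))%:C.
Proof.
have := tr_specmx2 U W a b 1%:M.
by rewrite trmxC1 (mulmx1 (specmx U a)) (mulmx1 (_ *m _)) (mulmx1 U).
Qed.

(** The squared overlaps of two orthonormal bases form a doubly stochastic matrix. A sum over one
    spectrum can thus be spread over pairs of eigenvalues and compared term by term. *)
Lemma sum_overlap_l (n : nat) (U W : 'M[R[i]]_n) (a : 'I_n -> R) :
  U \is unitarymx -> W \is unitarymx ->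
  \sum_i a i = \sum_i \sum_j a i * nsq ((U *m W^t*) i j).
Proof.
move=> uU uW; have := tr_specmxM U W a (fun=> 1).
rewrite (specmx1 uW) (mulmx1 (specmx U a)) mxtrace_specmx // => -[->].
by do 2!apply: eq_bigr => ? _; rewrite mulr1.
Qed.

Lemma sum_overlap_r (n : nat) (U W : 'M[R[i]]_n) (b : 'I_n -> R) :
  U \is unitarymx -> W \is unitarymx ->
  \sum_j b j = \sum_i \sum_j b j * nsq ((U *m W^t*) i j).
Proof.
move=> uU uW; have := tr_specmxM U W (fun=> 1) b.
rewrite (specmx1 uU) (mul1mx (specmx W b)) mxtrace_specmx // => -[->].
by do 2!apply: eq_bigr => ? _; rewrite mul1r.
Qed.

Definition qform (n : nat) (A : 'M[R[i]]_n) (x : 'cV[R[i]]_n) : R :=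
  complex.Re ((x^t* *m A *m x) 0 0).

Definition sqnorm (n : nat) (x : 'cV[R[i]]_n) : R := \sum_i nsq (x i 0).

Lemma qform_tr (n : nat) (A : 'M[R[i]]_n) x :
  qform A x = complex.Re (\tr (A *m (x *m x^t*))).
Proof.
by rewrite mulmxA mxtrace_mulC mulmxA /mxtrace big_ord1.
Qed.

Lemma qform_specmx (n : nat) (U : 'M[R[i]]_n) (a : 'I_n -> R) x :
  qform (specmx U a) x = \sum_i a i * nsq ((U *m x) i 0).
Proof.
rewrite qform_tr (@tr_specmx_mulmx n 1 U 1%:M); last first.
  by apply/unitarymxP; rewrite trmxC1 mulmx1.
by rewrite trmxC1 mulmx1; apply: eq_bigr => i _; rewrite big_ord1.
Qed.

Lemma qformD (n : nat) (A B : 'M[R[i]]_n) x :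
  qform (A + B) x = qform A x + qform B x.
Proof. by rewrite /qform mulmxDr mulmxDl mxE ReD. Qed.

Lemma qformZ (n : nat) (c : R) (A : 'M[R[i]]_n) x :
  qform (c%:C *: A) x = c * qform A x.
Proof. by rewrite /qform -scalemxAr -scalemxAl mxE Re_realM. Qed.

Lemma qform_conj (n m : nat) (V : 'M[R[i]]_(n, m)) (A : 'M[R[i]]_n) x :
  qform (V^t* *m A *m V) x = qform A (V *m x).
Proof. by rewrite /qform trmxC_mul !mulmxA. Qed.

Lemma sqnorm_ge0 (n : nat) (x : 'cV[R[i]]_n) : 0 <= sqnorm x.
Proof. by apply: sumr_ge0 => i _; exact: nsq_ge0. Qed.

Lemma sqnorm_gt0 (n : nat) (x : 'cV[R[i]]_n) : x != 0 -> 0 < sqnorm x.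
Proof.
move=> x0; rewrite lt0r sqnorm_ge0 andbT; apply: contra x0.
rewrite psumr_eq0 => [/allP h|i _]; last exact: nsq_ge0.
apply/eqP/colP => i; rewrite mxE; apply/eqP; rewrite -nsq_eq0.
by apply: h; rewrite mem_index_enum.
Qed.

Lemma sqnormE (n : nat) (x : 'cV[R[i]]_n) :
  sqnorm x = complex.Re ((x^t* *m x) 0 0).
Proof.
rewrite mxE Re_sum; apply: eq_bigr => i _; rewrite !mxE mulrC.
by rewrite [in RHS]mulcJ.
Qed.

Lemma sqnorm_isometry (n m : nat) (V : 'M[R[i]]_(n, m)) x :
  V^t* *m V = 1%:M -> sqnorm (V *m x) = sqnorm x.
Proof.
move=> hV; rewrite !sqnormE trmxC_mul -mulmxA [V^t* *m _]mulmxA hV.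
by rewrite mul1mx.
Qed.

Lemma sqnorm_unitary (n : nat) (U : 'M[R[i]]_n) x :
  U \is unitarymx -> sqnorm (U *m x) = sqnorm x.
Proof. by move=> uU; apply: sqnorm_isometry; exact: unitarymx_mulVmx. Qed.

(* x is a nonzero solution of a square system of linear equations, one of which
   reads 0 = 0. *)
Lemma common_vector (n m p : nat) (V : 'M[R[i]]_(n, m)) (W : 'M[R[i]]_m)
    (U : 'M[R[i]]_n) : (p < m)%N -> (m <= n)%N ->
  exists2 x : 'cV[R[i]]_m, x != 0 &
    (forall i : 'I_m, (i < p)%N -> (W *m x) i 0 = 0) /\
    (forall i : 'I_n, (p + (n - m) < i)%N -> (U *m (V *m x)) i 0 = 0).
Proof.
move=> pm mn.
(* For [i >= p], row [i] imposes the condition at index [i + (n - m) + 1]. For [i = m - 1] this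
   index is [n], out of range, which is where the zero row comes from. *)
pose B : 'M[R[i]]_m := \matrix_(i < m, l < m)
  if (i < p)%N then W i l else
  if insub (i + (n - m) + 1)%N is Some i' then (U *m V) i' l else 0.
have m1m : (m.-1 < m)%N by rewrite (ltn_predK pm).
have detB : \det B == 0.
  rewrite (expand_det_row _ (Ordinal m1m)) big1 // => j _; rewrite mxE /=.
  rewrite ltnNge -ltnS (ltn_predK pm) pm /= insubN ?mul0r //.
  by rewrite -leqNgt addn1 -addSn (ltn_predK pm) subnKC.
have /det0P[v v0 vB] : \det B^T == 0 by rewrite det_tr.
have Bv : B *m v^T = 0 by rewrite -[B]trmxK -trmx_mul vB trmx0.
exists v^T; first by rewrite -[0]trmx0 (inj_eq trmx_inj).
split=> i ip.
  have /colP/(_ i) := Bv; rewrite !mxE => Bvi; rewrite -[RHS]Bvi.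
  by apply: eq_bigr => l _; rewrite !mxE ip.
have il : (i - (n - m) - 1 < m)%N by have := ltn_ord i; lia.
have /colP/(_ (Ordinal il)) := Bv; rewrite mulmxA !mxE => Bvi; rewrite -[RHS]Bvi.
apply: eq_bigr => l _; rewrite [B _ _]mxE /=.
have -> : (i - (n - m) - 1 < p)%N = false by lia.
have -> : (i - (n - m) - 1 + (n - m) + 1 = i)%N by lia.
by rewrite valK.
Qed.

End trace_forms.

(** * Variational bounds for eigenvalues and for the trace exponential *)

Section eigenvalue_bounds.
Context {R : realType}.

Definition trexp (n : nat) (A : 'M[R[i]]_n) : R := complex.Re (\tr (expmx A)).

Lemma trexp_specmx (n : nat) (U : 'M[R[i]]_n) (a : 'I_n -> R) :
  U \is unitarymx -> trexp (specmx U a) = \sum_i expR (a i).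
Proof. by move=> uU; rewrite /trexp expmx_specmx // mxtrace_specmx. Qed.

Lemma trexp_ge0 (n : nat) (A : 'M[R[i]]_n) : A \is hermsymmx -> 0 <= trexp A.
Proof.
case/spectral_decomposition => U uU ->.
by rewrite trexp_specmx //; apply: sumr_ge0 => i _; exact: expR_ge0.
Qed.

(** Only the eigenvalues after the first [p] contribute to the quadratic form at [x], and
    [lambda p.+1 A] is the largest of them. *)
Lemma qform_le_lambda (n p : nat) (A U : 'M[R[i]]_n) x :
  A \is hermsymmx -> U \is unitarymx -> A = specmx U (fun i => lambda i.+1 A) ->
  (forall i : 'I_n, (i < p)%N -> (U *m x) i 0 = 0) ->
  qform A x <= lambda p.+1 A * sqnorm x.
Proof.
move=> hA uU AU Ux0; rewrite -(sqnorm_unitary x uU) {1}AU qform_specmx mulr_sumr.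
apply: ler_sum => i _; have [ip|pi] := ltnP i p.
  by rewrite Ux0 // /nsq /= expr0n /= addr0 !mulr0.
by rewrite ler_wpM2r ?nsq_ge0 // lambda_le.
Qed.

Lemma lambda_le_qform (n q : nat) (A U : 'M[R[i]]_n) x :
  A \is hermsymmx -> U \is unitarymx -> A = specmx U (fun i => lambda i.+1 A) ->
  (q < n)%N -> (forall i : 'I_n, (q < i)%N -> (U *m x) i 0 = 0) ->
  lambda q.+1 A * sqnorm x <= qform A x.
Proof.
move=> hA uU AU qn Ux0.
rewrite -(sqnorm_unitary x uU) {2}AU qform_specmx mulr_sumr.
apply: ler_sum => i _; have [iq|qi] := leqP i q.
  by rewrite ler_wpM2r ?nsq_ge0 // lambda_le.
by rewrite Ux0 // /nsq /= expr0n /= addr0 !mulr0.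
Qed.

(** The Rayleigh quotient at [x] forces the largest eigenvalue to be at least [s], and its
    exponential is one of the positive terms of the trace. *)
Lemma expR_le_trexp (n : nat) (A : 'M[R[i]]_n) (s : R) x :
  A \is hermsymmx -> x != 0 -> s * sqnorm x <= qform A x ->
  expR s <= trexp A.
Proof.
move=> hA x0 sA; have [U uU AU] := spectral_decomposition hA.
have n0 : (0 < n)%N.
  case: n x x0 {hA sA AU uU U A} => // x.
  by rewrite (_ : x = 0) ?eqxx //; apply/colP; case.
have s1 : s <= lambda 1 A.
  rewrite -(ler_pM2r (sqnorm_gt0 x0)); apply: (le_trans sA).
  by apply: (qform_le_lambda hA uU AU) => i.
rewrite AU trexp_specmx // (bigD1 (Ordinal n0)) //= ler_wpDr //.
  by apply: sumr_ge0 => i _; exact: expR_ge0.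
by rewrite ler_expR.
Qed.

(** Courant-Fischer: by dimension count some [x <> 0] is orthogonal to the top [j] eigenvectors of
    the compression while [V x] lies in the span of the top [j + (n - m) + 1] eigenvectors of [A].
    The quadratic form at [x] then separates the two eigenvalues. *)
Lemma poincare_separation (n m j : nat) (A : 'M[R[i]]_n) (V : 'M[R[i]]_(n, m)) :
  A \is hermsymmx -> V^t* *m V = 1%:M -> (m <= n)%N -> (j < m)%N ->
  lambda (j + (n - m)).+1 A <= lambda j.+1 (V^t* *m A *m V).
Proof.
move=> hA hV mn jm; have hB := hermsymmx_conj V hA.
have [U uU AU] := spectral_decomposition hA.
have [W uW BW] := spectral_decomposition hB.
have [x x0 [Wx Ux]] := common_vector V W U jm mn.
rewrite -(ler_pM2r (sqnorm_gt0 x0)).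
apply: le_trans (qform_le_lambda hB uW BW Wx).
rewrite qform_conj -(sqnorm_isometry x hV).
by apply: (lambda_le_qform hA uU AU) => //; lia.
Qed.

(* Gibbs' variational principle; a zero eigenvalue kap j is harmless since
   ln 0 = 0. *)
Lemma gibbs_trexp (n : nat) (W S : 'M[R[i]]_n) (kap : 'I_n -> R) :
  W \is unitarymx -> S \is hermsymmx -> (forall j, 0 <= kap j) ->
  \sum_j kap j <=
    trexp S + \sum_j kap j * ln (kap j) - complex.Re (\tr (S *m specmx W kap)).
Proof.
move=> uW /spectral_decomposition[U uU SU] kap0.
rewrite SU; move: (fun i : 'I_n => lambda i.+1 S) => s {SU S}.
rewrite trexp_specmx // (sum_overlap_r kap uU uW).
rewrite (sum_overlap_l (fun i => expR (s i)) uU uW).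
rewrite (sum_overlap_r (fun j => kap j * ln (kap j)) uU uW).
rewrite (congr1 (@complex.Re R) (tr_specmxM U W s kap)) /=.
rewrite -!sumrN -!big_split /=.
apply: ler_sum => i _; rewrite -!sumrN -!big_split /=.
apply: ler_sum => j _; set c := nsq _; have c0 : 0 <= c by exact: nsq_ge0.
rewrite -mulrDl -mulrBl ler_wpM2r //.
have := kap0 j; rewrite le_eqVlt => /orP[/eqP <-|k0].
  by rewrite !(mul0r, mulr0) addr0 subr0 expR_ge0.
(* The scalar case is [1 + u <= e^u] at [u = s i - ln (kap j)], multiplied by [kap j]. *)
have := expR_ge1Dx (s i - ln (kap j)).
by rewrite expRB lnK ?posrE // ler_pdivlMr //; lra.
Qed.

End eigenvalue_bounds.
(** * Lieb's inequality *)

Lemma segment_gt0 (R : realType) (t x y : R) :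
  0 <= t <= 1 -> 0 < x -> 0 < y -> 0 < x + t * (y - x).
Proof.
move=> /andP[t0 t1] x0 y0.
have -> : x + t * (y - x) = (1 - t) * x + t * y by ring.
have [->|tn0] := eqVneq t 0; first by rewrite subr0 mul1r mul0r addr0.
by rewrite ltr_wpDl ?mulr_ge0 ?subr_ge0 ?(ltW x0) // mulr_gt0 // lt0r tn0.
Qed.

(** * Riemann sums for the logarithm *)

Section log_riemann_sums.
Context {R : realType}.
Variables (N : nat) (kap mu : R).
Hypotheses (N_gt0 : (0 < N)%N) (mu_gt0 : 0 < mu).

(** Equally spaced nodes from [mu] to [kap]; they decrease when [kap < mu]. *)
Let p (k : nat) : R := mu + (k%:R / N%:R) * (kap - mu).

Let N_neq0 : N%:R != 0 :> R.
Proof. by rewrite pnatr_eq0 -lt0n. Qed.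

Let p0 : p 0 = mu.
Proof. by rewrite /p mul0r mul0r addr0. Qed.

Let pN : p N = kap.
Proof. by rewrite /p divff // mul1r; ring. Qed.

Let p_gt0 k : 0 < kap -> (k <= N)%N -> 0 < p k.
Proof.
move=> kap_gt0 kN; apply: segment_gt0 => //.
by rewrite divr_ge0 ?ler0n //= ler_pdivrMr ?ltr0n // mul1r ler_nat.
Qed.

(** Since [1/x] decreases, the right-endpoint sum lies below the integral of [1/x] from [mu] to
    [kap], in whichever direction the nodes run. On each cell this is [1 - 1/x <= ln x] at
    [x = p k.+1 / p k]. *)
Lemma riemann_le_ln : 0 < kap ->
  N%:R^-1 * (\sum_(k < N) kap * (kap - mu) / p k.+1) <=
  kap * (ln kap - ln mu).
Proof.
move=> kap_gt0; rewrite -pN -p0 -(telescope_sumr (fun k => ln (p k))) //.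
rewrite pN big_mkord !mulr_sumr; apply: ler_sum => k _.
have k1 : 0 < p k.+1 by apply: p_gt0.
have k0 : 0 < p k by apply: p_gt0 => //; exact: ltnW.
have -> : N%:R^-1 * (kap * (kap - p 0) / p k.+1) = kap * (1 - p k / p k.+1).
  have -> : p k = p k.+1 - N%:R^-1 * (kap - p 0).
    by rewrite p0 /p -natr1; field.
  by field; rewrite N_neq0 gt_eqF.
rewrite ler_wpM2l ?(ltW kap_gt0) // -ln_div ?posrE //.
rewrite -[X in ln X]invf_div lnV ?posrE ?divr_gt0 //.
have := @le_ln1Dx R (p k / p k.+1 - 1); rewrite subrKC.
rewrite lerNr opprB; apply.
by rewrite ltrBrDr addNr divr_gt0.
Qed.

(** The left-endpoint sum lies above the integral, and it exceeds the right-endpoint sum by a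
    telescoping quantity of order [1/N]. *)
Lemma ln_le_riemann : 0 < kap ->
  kap * (ln kap - ln mu) <=
  N%:R^-1 * (\sum_(k < N) kap * (kap - mu) / p k.+1) +
  N%:R^-1 * ((kap - mu) ^+ 2 / mu).
Proof.
move=> kap_gt0.
apply: (@le_trans _ _ (N%:R^-1 * (\sum_(k < N) kap * (kap - mu) / p k))).
  rewrite -[in ln kap]pN -[in ln mu]p0 -(telescope_sumr (fun k => ln (p k))) //.
  rewrite big_mkord !mulr_sumr; apply: ler_sum => k _.
  have k1 : 0 < p k.+1 by apply: p_gt0.
  have k0 : 0 < p k by apply: p_gt0 => //; exact: ltnW.
  have -> : N%:R^-1 * (kap * (kap - mu) / p k) = kap * (p k.+1 / p k - 1).
    have -> : p k.+1 = p k + N%:R^-1 * (kap - mu) by rewrite /p -natr1; field.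
    by field; rewrite N_neq0 gt_eqF.
  rewrite ler_wpM2l ?(ltW kap_gt0) // -ln_div ?posrE //.
  have := @le_ln1Dx R (p k.+1 / p k - 1); rewrite subrKC; apply.
  by rewrite ltrBrDr addNr divr_gt0.
(* The difference of the two sums telescopes to [kap (kap - mu) (1/mu - 1/kap)], which is
   [(kap - mu)^2 / mu]. *)
rewrite -mulrDr ler_wpM2l ?invr_ge0 ?ler0n // -lerBlDl -sumrB.
under eq_bigr do rewrite -mulrBr.
rewrite -mulr_sumr -(big_mkord xpredT (fun k => (p k)^-1 - (p k.+1)^-1)).
under eq_bigr do rewrite -opprB.
rewrite sumrN telescope_sumr // p0 pN le_eqVlt; apply/orP; left; apply/eqP.
by field; rewrite !gt_eqF.
Qed.

End log_riemann_sums.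

(** * Each Riemann term as the maximum of a quadratic function *)

Section supporting_functional.
Context {R : realType}.
Implicit Types (s kap mu : R).

(** The left side is quadratic in [z] with leading coefficient [- s m], where
    [m = s mu + (1 - s) kap > 0]. Completing the square, the two sides differ by [s m] times the
    squared modulus of [z - c (kap - mu) / m]. *)
Lemma entry_le s kap mu (c z : R[i]) : 0 <= s <= 1 -> 0 < kap -> 0 < mu ->
  (kap - mu) * nsq (c + s%:C * z) - s * kap * nsq z <=
  nsq c * (kap * (kap - mu) / (mu + (1 - s) * (kap - mu))).
Proof.
move=> /andP[s0 s1] kap0 mu0; set m := mu + _.
have m0 : 0 < m.
  by apply: segment_gt0 => //; rewrite subr_ge0 s1 lerBlDr lerDl.
rewrite -subr_ge0; case: c => c1 c2; case: z => z1 z2; rewrite /nsq /= !mul0r subr0 addr0.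
set r := (kap - mu) / m.
rewrite (_ : _ - _ = s * m * ((z1 - c1 * r) ^+ 2 + (z2 - c2 * r) ^+ 2)).
  by rewrite mulr_ge0 ?addr_ge0 ?sqr_ge0 // mulr_ge0 // ltW.
by rewrite /r /m; field; rewrite -/m gt_eqF.
Qed.

(** The value at the maximizer [z = rho c] of [entry_le]. It is left unsimplified in [rho] so that
    it still makes sense when the denominator vanishes. *)
Lemma entry_eq s kap mu (c : R[i]) :
  let rho := (kap - mu) / (mu + (1 - s) * (kap - mu)) in
  (kap - mu) * nsq (c + s%:C * (rho%:C * c)) - s * kap * nsq (rho%:C * c) =
  nsq c * ((kap - mu) * (1 + s * rho) ^+ 2 - s * kap * rho ^+ 2).
Proof.
by move=> rho; case: c => c1 c2; rewrite /nsq /= !mul0r !subr0 !addr0; ring.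
Qed.

(** For [kap > 0] each summand equals the corresponding right-endpoint Riemann term, so this is
    [ln_le_riemann]. The case [kap = 0] is included because an averaged matrix is only known here to
    have nonnegative eigenvalues. *)
Lemma ln_le_entries (N : nat) kap mu : (0 < N)%N -> 0 <= kap -> 0 < mu ->
  kap * (ln kap - ln mu) <=
  N%:R^-1 * (\sum_(k < N)
    let s := 1 - k.+1%:R / N%:R in
    let rho := (kap - mu) / (mu + (1 - s) * (kap - mu)) in
    ((kap - mu) * (1 + s * rho) ^+ 2 - s * kap * rho ^+ 2)) +
  N%:R^-1 * ((kap - mu) ^+ 2 / mu).
Proof.
case: N => // N _; rewrite le_eqVlt => /orP[/eqP <-|kap0] mu0 /=.
  rewrite mul0r -mulrDr mulr_ge0 ?invr_ge0 ?ler0n //.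
  (* At [kap = 0] all terms but the last vanish, as [rho = - 1/s]. In the last one [s = 0], so [rho]
     is a division by zero with value 0 and the term is [- mu], which the remainder cancels. *)
  rewrite big_ord_recr /= big1 => [|k _].
    rewrite divff ?pnatr_eq0 // subrr sub0r !mul0r addr0 subr0 expr1n mulr1 add0r.
    by rewrite sqrrN expr2 mulfK ?gt_eqF // addNr.
  rewrite mulr0 mul0r subr0; set t := _ / _.
  have t1 : t < 1 by rewrite ltr_pdivrMr ?ltr0n // mul1r ltr_nat ltnS ltn_ord.
  have -> : mu + (1 - (1 - t)) * (0 - mu) = (1 - t) * mu by ring.
  by field; rewrite gt_eqF // subr_eq0 gt_eqF.
apply: (le_trans (ln_le_riemann (ltn0Sn N) mu0 kap0)).
rewrite lerD2r ler_wpM2l ?invr_ge0 ?ler0n //; apply: ler_sum => k _.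
rewrite opprB addrCA subrr addr0; set t := _ / _.
have t01 : 0 <= t <= 1.
  by rewrite divr_ge0 ?ler0n //= ler_pdivrMr ?ltr0n // mul1r ler_nat.
rewrite le_eqVlt; apply/orP; left; apply/eqP; field.
by rewrite gt_eqF // segment_gt0.
Qed.

End supporting_functional.

(** * The linear functionals below the relative entropy *)

Section trace_functional.
Context {R : realType}.

Definition rtr (m n : nat) (A : 'M[R[i]]_(m, n)) (B : 'M[R[i]]_(n, m)) : R :=
  complex.Re (\tr (A *m B)).

Lemma rtrDl (m n : nat) (A A' : 'M[R[i]]_(m, n)) B :
  rtr (A + A') B = rtr A B + rtr A' B.
Proof. by rewrite /rtr mulmxDl mxtraceD ReD. Qed.

Lemma rtrNl (m n : nat) (A : 'M[R[i]]_(m, n)) B : rtr (- A) B = - rtr A B.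
Proof. by rewrite /rtr mulNmx raddfN /= ReN. Qed.

Lemma rtrBl (m n : nat) (A A' : 'M[R[i]]_(m, n)) B :
  rtr (A - A') B = rtr A B - rtr A' B.
Proof. by rewrite rtrDl rtrNl. Qed.

Lemma rtrZl (m n : nat) (a : R) (A : 'M[R[i]]_(m, n)) B :
  rtr (a%:C *: A) B = a * rtr A B.
Proof. by rewrite /rtr -scalemxAl mxtraceZ Re_realM. Qed.

Lemma rtr0l (m n : nat) (B : 'M[R[i]]_(n, m)) : rtr (0 : 'M[R[i]]_(m, n)) B = 0.
Proof. by rewrite /rtr mul0mx raddf0. Qed.

Lemma rtr_suml (I : Type) (s : seq I) (m n : nat) (A : I -> 'M[R[i]]_(m, n)) B :
  rtr (\sum_(i <- s) A i) B = \sum_(i <- s) rtr (A i) B.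
Proof. by apply: (big_morph (fun A => rtr A B)) => [A1 A2|]; rewrite (rtrDl, rtr0l). Qed.

Lemma rtrC (m n : nat) (A : 'M[R[i]]_(m, n)) B : rtr A B = rtr B A.
Proof. by rewrite /rtr mxtrace_mulC. Qed.

Lemma rtr_specmxM (n : nat) (U W : 'M[R[i]]_n) (a b : 'I_n -> R) :
  rtr (specmx U a) (specmx W b) =
  \sum_i \sum_j a i * b j * nsq ((U *m W^t*) i j).
Proof. by rewrite /rtr tr_specmxM. Qed.

(** By cyclicity this is the trace of [F^t* D F], a sum of quadratic forms of [D] at the columns of
    [F]. *)
Lemma rtr_gram_psdmx (m n : nat) (F : 'M[R[i]]_(n, m)) (D : 'M[R[i]]_n) :
  psdmx D -> 0 <= rtr (F *m F^t*) D.
Proof.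
case=> _ D0; rewrite /rtr -mulmxA mxtrace_mulC /mxtrace Re_sum.
apply: sumr_ge0 => j _; have := D0 (col j F); rewrite lecE => /andP[_] /=.
congr (_ <= complex.Re _); rewrite !mxE; apply: eq_bigr => l _.
rewrite [col j F l 0]mxE; congr (_ * _); rewrite !mxE.
by apply: eq_bigr => q _; rewrite !mxE.
Qed.

Variable N : nat.

(** This is the [s] for which [mu + (1 - s) (kap - mu)] is the right endpoint of cell [k]; it
    vanishes on the last cell. *)
Definition riemann_step (k : 'I_N) : R := 1 - k.+1%:R / N%:R.

Section functional.
Variables (n : nat) (Z : 'I_N -> 'M[R[i]]_n).

Definition affine_mx (k : 'I_N) : 'M[R[i]]_n :=
  1%:M + (riemann_step k)%:C *: Z k.

(** Together with [support_neg], the coefficients of a functional linear in the pair of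
    exponentials. The matrices [Z k] are free parameters that play the role of [z] in [entry_le]. *)
Definition support_pos : 'M[R[i]]_n :=
  (N%:R^-1)%:C *: \sum_k ((affine_mx k)^t* *m affine_mx k -
                         (riemann_step k)%:C *: ((Z k)^t* *m Z k)).

Definition support_neg : 'M[R[i]]_n :=
  (N%:R^-1)%:C *: \sum_k (affine_mx k *m (affine_mx k)^t*).

Lemma support_neg_psdmx (D : 'M[R[i]]_n) : psdmx D -> 0 <= rtr support_neg D.
Proof.
move=> hD; rewrite rtrZl mulr_ge0 ?invr_ge0 ?ler0n // rtr_suml.
by apply: sumr_ge0 => k _; exact: rtr_gram_psdmx.
Qed.

Lemma support_specmx (U W : 'M[R[i]]_n) (mu kap : 'I_n -> R) :
  U \is unitarymx -> W \is unitarymx ->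
  rtr support_pos (specmx W kap) - rtr support_neg (specmx U mu) =
  \sum_i \sum_j N%:R^-1 * \sum_k
    ((kap j - mu i) *
       nsq ((U *m W^t*) i j + (riemann_step k)%:C * (U *m Z k *m W^t*) i j) -
     riemann_step k * kap j * nsq ((U *m Z k *m W^t*) i j)).
Proof.
move=> uU uW; rewrite !rtrZl !rtr_suml -mulrBr -sumrB mulr_sumr.
rewrite [RHS](eq_bigr _ (fun i _ => eq_bigr _ (fun j _ => mulr_sumr _ _ _ _))).
rewrite [RHS](eq_bigr _ (fun i _ => exchange_big _ _ _ _ _ _)) /= exchange_big /=.
apply: eq_bigr => k _; rewrite rtrBl rtrZl.
have aff i j : (U *m affine_mx k *m W^t*) i j =
    (U *m W^t*) i j + (riemann_step k)%:C * (U *m Z k *m W^t*) i j.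
  by rewrite mulmxDr mulmx1 mulmxDl mxE -scalemxAr -scalemxAl [X in _ + X]mxE.
rewrite {1 2}/rtr !(tr_mulmx_specmx _ _ _ uU) [rtr (_ *m _) _]rtrC.
rewrite /rtr (tr_specmx_mulmx _ _ _ uW) /=.
rewrite mulr_sumr -!sumrB mulr_sumr; apply: eq_bigr => i _.
rewrite mulr_sumr -!sumrB mulr_sumr; apply: eq_bigr => j _.
by rewrite !aff; ring.
Qed.

(** In the eigenbases of [S] and [X] the claim splits over pairs of eigenvalues. There [entry_le]
    bounds each summand for any [Z], and [riemann_le_ln] bounds the resulting sum. *)
Lemma support_le (S X : 'M[R[i]]_n) : (0 < N)%N ->
  S \is hermsymmx -> X \is hermsymmx ->
  rtr support_pos (expmx S) - rtr support_neg (expmx X) <= rtr (S - X) (expmx S).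
Proof.
move=> N0 /spectral_expmx[W [s [uW SW eS]]] /spectral_expmx[U [x [uU XU eX]]].
rewrite eS eX (support_specmx _ _ uU uW) rtrBl SW XU.
have -> : rtr (specmx W s) (specmx W (fun j => expR (s j))) =
    \sum_i \sum_j expR (s j) * s j * nsq ((U *m W^t*) i j).
  rewrite /rtr (specmxM uW) (mxtrace_specmx uW) (sum_overlap_r _ uU uW) /=.
  by apply: eq_bigr => i _; apply: eq_bigr => j _; rewrite [s j * _]mulrC.
have -> : rtr (specmx U x) (specmx W (fun j => expR (s j))) =
    \sum_i \sum_j x i * expR (s j) * nsq ((U *m W^t*) i j).
  by rewrite rtr_specmxM.
rewrite -sumrB; apply: ler_sum => i _; rewrite -sumrB; apply: ler_sum => j _.
set c := (U *m W^t*) i j.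
have e0 := expR_gt0 (s j); have m0 := expR_gt0 (x i).
have := riemann_le_ln N0 m0 e0; rewrite !expRK => /(ler_wpM2l (nsq_ge0 c)) h.
rewrite -mulrBl (_ : (_ - _) * nsq c = nsq c * (expR (s j) * (s j - x i))); last by ring.
apply: le_trans h; rewrite mulrCA ler_wpM2l ?invr_ge0 ?ler0n // mulr_sumr.
apply: ler_sum => k _; apply: le_trans (entry_le c _ _ e0 m0) _.
  rewrite subr_ge0 lerBlDr lerDl divr_ge0 ?ler0n // ler_pdivrMr ?ltr0n //.
  by rewrite mul1r ler_nat ltn_ord.
by rewrite opprB addrCA subrr addr0.
Qed.

End functional.

End trace_functional.

Section supporting_hyperplane.
Context {R : realType}.

(* Riemann sums for the logarithm, in the form
   kap (ln kap - ln mu) = \int_0^1 kap (kap - mu) / (s mu + t kap) dt with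
   s + t = 1, turn the quantum relative entropy D(e^S; e^X) = tr e^S (S - X)
   into a limit of suprema of functionals that are linear in (e^S, e^X). *)
Lemma supporting_hyperplane (n : nat) (W B : 'M[R[i]]_n) (kap : 'I_n -> R)
    (eps : R) :
  W \is unitarymx -> B \is hermsymmx -> (forall j, 0 <= kap j) -> 0 < eps ->
  exists C G : 'M[R[i]]_n,
    [/\ forall S X, S \is hermsymmx -> X \is hermsymmx ->
          rtr C (expmx S) - rtr G (expmx X) <= rtr (S - X) (expmx S),
        forall D, psdmx D -> 0 <= rtr G D &
        \sum_j kap j * ln (kap j) - rtr B (specmx W kap) <=
          rtr C (specmx W kap) - rtr G (expmx B) + eps].
Proof.
move=> uW hB kap0 eps0; have [U uU BU] := spectral_decomposition hB.
set b := (fun i : 'I_n => lambda i.+1 B) in BU.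
pose mu i := expR (b i); pose c := U *m W^t*.
pose err := \sum_i \sum_j nsq (c i j) * ((kap j - mu i) ^+ 2 / mu i).
(* [err / N] is the total discretization error of [ln_le_entries], weighted by the overlaps. *)
have [N N0 hN] : exists2 N : nat, (0 < N)%N & N%:R^-1 * err <= eps.
  exists (Num.truncn (err / eps)).+1 => //.
  rewrite mulrC ler_pdivrMr ?ltr0n // mulrC -ler_pdivrMr //.
  exact/ltW/truncnS_gt.
(* The parameters [Z k] are chosen so that, in the eigenbases [U] and [W], their entries are the
   maximizers of [entry_le]; this makes the bound sharp up to [eps]. *)
pose rho (k : 'I_N) i j := (kap j - mu i) /
  (mu i + (1 - riemann_step k) * (kap j - mu i)) : R.
pose Z (k : 'I_N) := U^t* *m (\matrix_(i, j) ((rho k i j)%:C * c i j)) *m W.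
have zE k i j : (U *m Z k *m W^t*) i j = (rho k i j)%:C * c i j.
  rewrite /Z !mulmxA (unitarymxP uU) mul1mx -mulmxA (unitarymxP uW).
  by rewrite mulmx1 [LHS]mxE.
exists (support_pos Z), (support_neg Z); split.
- by move=> S X; exact: support_le.
- exact: support_neg_psdmx.
rewrite {2}BU expmx_specmx // support_specmx //.
apply: (le_trans _ (lerD (lexx _) hN)).
rewrite (sum_overlap_r (fun j => kap j * ln (kap j)) uU uW).
rewrite {1}BU rtr_specmxM.
rewrite mulr_sumr -sumrB -big_split /=; apply: ler_sum => i _.
rewrite mulr_sumr -sumrB -big_split /=; apply: ler_sum => j _.
have := ln_le_entries N0 (kap0 j) (expR_gt0 (b i)).
rewrite -/(mu i) /mu expRK -/(mu i) => /(ler_wpM2l (nsq_ge0 (c i j))).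
set Q := \sum_(k < N) _ => h.
rewrite (_ : \sum_k _ = nsq (c i j) * Q); last first.
  rewrite mulr_sumr; apply: eq_bigr => k _.
  by rewrite zE; exact: entry_eq.
by apply: (le_trans _ (le_trans h _)); rewrite le_eqVlt; apply/orP; left; apply/eqP; ring.
Qed.

End supporting_hyperplane.
(** * Random matrices *)

Section measurable_matrices.
Context {R : realType} {d : measure_display} {T : measurableType d}.

(** Entrywise, and over an arbitrary measurable space, so that it also applies to sub-sigma-algebras
    of [T] and to their products. *)
Definition measurable_mx (m n : nat) (F : T -> 'M[R[i]]_(m, n)) : Prop :=
  forall i j, measurable_fun [set: T] (fun w => complex.Re (F w i j)) /\
              measurable_fun [set: T] (fun w => complex.Im (F w i j)).

Lemma measurable_mx_cst (m n : nat) (A : 'M[R[i]]_(m, n)) :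
  measurable_mx (fun=> A).
Proof. by move=> i j; split; exact: measurable_cst. Qed.

Lemma measurable_mxD (m n : nat) (F G : T -> 'M[R[i]]_(m, n)) :
  measurable_mx F -> measurable_mx G -> measurable_mx (fun w => F w + G w).
Proof.
move=> mF mG i j; have [? ?] := mF i j; have [? ?] := mG i j; split.
  by under eq_fun do rewrite mxE ReD; exact: measurable_funD.
by under eq_fun do rewrite mxE ImD; exact: measurable_funD.
Qed.

Lemma measurable_mx_sum (I : Type) (s : seq I) (Q : pred I) (m n : nat)
    (F : I -> T -> 'M[R[i]]_(m, n)) : (forall i, Q i -> measurable_mx (F i)) ->
  measurable_mx (fun w => \sum_(i <- s | Q i) F i w).
Proof.
move=> mF; elim: s => [|i s IHs].
  by under eq_fun do rewrite big_nil; exact: measurable_mx_cst.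
case Qi: (Q i); under eq_fun do rewrite big_cons Qi; last exact: IHs.
by apply: measurable_mxD => //; exact: mF.
Qed.

Lemma measurable_mxM (m n p : nat) (F : T -> 'M[R[i]]_(m, n))
    (G : T -> 'M[R[i]]_(n, p)) :
  measurable_mx F -> measurable_mx G -> measurable_mx (fun w => F w *m G w).
Proof.
move=> mF mG i j; split.
  under eq_fun do rewrite mxE Re_sum; apply: measurable_sum => l.
  have [? ?] := mF i l; have [? ?] := mG l j.
  by under eq_fun do rewrite ReM; apply: measurable_funB; exact: measurable_funM.
under eq_fun do rewrite mxE Im_sum; apply: measurable_sum => l.
have [? ?] := mF i l; have [? ?] := mG l j.
by under eq_fun do rewrite ImM; apply: measurable_funD; exact: measurable_funM.
Qed.

Lemma measurable_mxZ (m n : nat) (a : R) (F : T -> 'M[R[i]]_(m, n)) :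
  measurable_mx F -> measurable_mx (fun w => a%:C *: F w).
Proof.
move=> mF i j; have [? ?] := mF i j; split.
  by under eq_fun do rewrite mxE Re_realM; exact: measurable_funM.
by under eq_fun do rewrite mxE Im_realM; exact: measurable_funM.
Qed.

(** The exponential is a pointwise limit of polynomials in [F]; self-adjointness provides the
    convergence through diagonalization. *)
Lemma measurable_expmx (n : nat) (F : T -> 'M[R[i]]_n) :
  (forall w, F w \is hermsymmx) -> measurable_mx F ->
  measurable_mx (fun w => expmx (F w)).
Proof.
move=> hF mF.
have mX k : measurable_mx (fun w => F w ^+ k).
  elim: k => [|k IHk]; first exact: measurable_mx_cst.
  by under eq_fun do rewrite exprS; exact: measurable_mxM.
have mS N : measurable_mx (fun w => expmx_psum (F w) N).
  apply: measurable_mx_sum => k _.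
  rewrite (_ : k`!%:R^-1 = (k`!%:R^-1 : R)%:C); last by rewrite fmorphV rmorph_nat.
  exact: measurable_mxZ.
move=> i j; split.
  apply: (measurable_fun_cvg (fun N => (mS N i j).1)) => w _.
  have [U uU ->] := spectral_decomposition (hF w).
  by rewrite expmx_specmx //; exact: cvg_Re_expmx_psum.
apply: (measurable_fun_cvg (fun N => (mS N i j).2)) => w _.
have [U uU ->] := spectral_decomposition (hF w).
by rewrite expmx_specmx //; exact: cvg_Im_expmx_psum.
Qed.

Lemma rtr_entries (m n : nat) (C : 'M[R[i]]_(m, n)) (Y : 'M[R[i]]_(n, m)) :
  rtr C Y = \sum_i \sum_j (complex.Re (C i j) * complex.Re (Y j i) -
                           complex.Im (C i j) * complex.Im (Y j i)).
Proof.
rewrite /rtr /mxtrace Re_sum; apply: eq_bigr => i _.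
by rewrite mxE Re_sum; apply: eq_bigr => j _; rewrite ReM.
Qed.

Lemma measurable_trexp (n : nat) (F : T -> 'M[R[i]]_n) :
  (forall w, F w \is hermsymmx) -> measurable_mx F ->
  measurable_fun [set: T] (fun w => trexp (F w)).
Proof.
move=> hF mF; rewrite /trexp /mxtrace; under eq_fun do rewrite Re_sum.
by apply: measurable_sum => i; have [] := measurable_expmx hF mF i i.
Qed.

End measurable_matrices.

(** * Expectations of random matrices *)

Section expectation.
Context {R : realType} {d : measure_display} {T : measurableType d}.
Variable P : probability T R.

Lemma integrable_rtr (n : nat) (C : 'M[R[i]]_n) (Y : T -> 'M[R[i]]_n) :
  integrable_mx P Y -> P.-integrable [set: T] (EFin \o (fun w => rtr C (Y w))).
Proof.
move=> iY; rewrite /comp; under eq_fun do rewrite rtr_entries -sumEFin.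
apply: integrable_sum => // i _; under eq_fun do rewrite -sumEFin.
apply: integrable_sum => // j _; have [iRe iIm] := iY j i.
under eq_fun do rewrite EFinB !EFinM.
by apply: integrableB => //; exact: integrableZl.
Qed.

Lemma Rintegral_sum (I : Type) (s : seq I) (f : I -> T -> R) :
  (forall i, P.-integrable [set: T] (EFin \o f i)) ->
  (\int[P]_w (\sum_(i <- s) f i w) = \sum_(i <- s) \int[P]_w (f i w))%R.
Proof.
move=> intf; elim: s => [|i s IHs].
  under eq_Rintegral do rewrite big_nil.
  by rewrite big_nil /Rintegral integral0.
under eq_Rintegral do rewrite big_cons.
rewrite RintegralD // ?IHs ?big_cons //.
rewrite /comp; under eq_fun do rewrite -sumEFin.
by apply: integrable_sum => // j _; exact: intf.
Qed.

Lemma rtr_expectation (n : nat) (C : 'M[R[i]]_n) (Y : T -> 'M[R[i]]_n) :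
  integrable_mx P Y ->
  rtr C (expectation_mx P Y) = (\int[P]_w rtr C (Y w))%R.
Proof.
move=> iY.
have iZ (c : R) (f : T -> R) : P.-integrable [set: T] (EFin \o f) ->
    P.-integrable [set: T] (EFin \o (fun w => c * f w)).
  by move=> intf; rewrite /comp; under eq_fun do rewrite EFinM; exact: integrableZl.
have iB i j : P.-integrable [set: T] (EFin \o (fun w =>
    complex.Re (C i j) * complex.Re (Y w j i) -
    complex.Im (C i j) * complex.Im (Y w j i))).
  rewrite /comp; under eq_fun do rewrite EFinB.
  by have [? ?] := iY j i; apply: integrableB => //; exact: iZ.
under eq_Rintegral do rewrite rtr_entries.
rewrite rtr_entries Rintegral_sum => [|i]; last first.
  rewrite /comp; under eq_fun do rewrite -sumEFin.
  by apply: integrable_sum => // j _; exact: iB.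
apply: eq_bigr => i _; rewrite Rintegral_sum //; apply: eq_bigr => j _.
have [iRe iIm] := iY j i.
rewrite RintegralB ?RintegralZl //; try exact: iZ.
by rewrite mxE /= !unlock.
Qed.

Lemma expectation_mx_herm (n : nat) (Y : T -> 'M[R[i]]_n) :
  (forall w, Y w \is hermsymmx) -> integrable_mx P Y ->
  expectation_mx P Y \is hermsymmx.
Proof.
move=> hY iY; apply/hermsymmxP/matrixP => i j; rewrite !mxE conjC_conjc /= !unlock.
have hYE w : complex.Re (Y w i j) = complex.Re (Y w j i) /\
    complex.Im (Y w i j) = - complex.Im (Y w j i).
  move/hermsymmxP/matrixP/(_ i j): (hY w); rewrite !mxE conjC_conjc => ->.
  by case: (Y w j i).
congr (_ +i* _); first by congr fine; apply: eq_integral => w _; rewrite (hYE w).1.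
rewrite -mulN1r -[RHS]RintegralZl //; last by have [] := iY j i.
by congr fine; apply: eq_integral => w _; rewrite (hYE w).2 mulN1r.
Qed.

(** An entry is a combination of the eigenvalues [e^(s l)] with coefficients of modulus at most 1,
    because the rows of [U] are unit vectors. *)
Lemma expmx_entry_le (n : nat) (S : 'M[R[i]]_n) i j : S \is hermsymmx ->
  `|complex.Re (expmx S i j)| <= trexp S /\
  `|complex.Im (expmx S i j)| <= trexp S.
Proof.
case/spectral_decomposition => U uU SU.
move: SU; set s := (fun i => _) => SU.
have entry_le l k : nsq (U l k) <= 1.
  have /matrixP/(_ l l) := unitarymxP uU; rewrite !mxE eqxx mulr1n.
  move=> /(congr1 (@complex.Re R)) /=; rewrite Re_sum => <-.
  rewrite (bigD1 k) //= !mxE mulcJ /= lerDl; apply: sumr_ge0 => q _.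
  by rewrite !mxE mulcJ /= nsq_ge0.
have prod_le l : nsq (Num.conj (U l i) * U l j) <= 1.
  have -> (z w : R[i]) : nsq (z * w) = nsq z * nsq w.
    by case: z => ? ?; case: w => ? ?; rewrite /nsq /=; ring.
  by rewrite nsqC -[1]mulr1 ler_pM ?nsq_ge0.
have abs_le1 (x y : R) : x ^+ 2 + y ^+ 2 <= 1 -> `|x| <= 1 /\ `|y| <= 1.
  move=> h; split; rewrite -(@expr_le1 _ 2) // real_normK ?num_real //;
    apply: le_trans h; rewrite ?lerDl ?lerDr sqr_ge0 //.
rewrite {1 2 3}SU expmx_specmx // specmxE Re_sum Im_sum SU trexp_specmx //.
split; apply: (le_trans (ler_norm_sum _ _ _)); apply: ler_sum => l _.
  rewrite Re_realM normrM ger0_norm ?expR_ge0 // ler_piMr ?expR_ge0 //.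
  by have [] := abs_le1 _ _ (prod_le l).
rewrite Im_realM normrM ger0_norm ?expR_ge0 // ler_piMr ?expR_ge0 //.
by have [] := abs_le1 _ _ (prod_le l).
Qed.

End expectation.

(** * The inequality (Lieb-Tropp) for one random summand *)

Section lieb_jensen.
Context {R : realType} {d : measure_display} {T : measurableType d}.
Variable P : probability T R.

Lemma rtr_addK (n : nat) (H X Y : 'M[R[i]]_n) : rtr (H + X - X) Y = rtr H Y.
Proof. by rewrite addrK. Qed.

(** Since [H] is at most the scalar [c], the factor [e^c] suffices. The comparison comes from Gibbs'
    principle for [X + c] tested against [Y = e^(H + X)]. It serves as a domination bound for
    integrability. *)
Lemma trexp_shift_le (n : nat) (H : 'M[R[i]]_n) : H \is hermsymmx ->
  exists2 c : R, 0 <= c & forall X : 'M[R[i]]_n, X \is hermsymmx ->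
    trexp (H + X) <= c * trexp X.
Proof.
move=> hH; have [V uV HV] := spectral_decomposition hH.
set h := (fun i => _) in HV.
pose c := \sum_i `|h i|; exists (expR c); first exact: expR_ge0.
move=> X hX; have [W uW HXW] := spectral_decomposition (hermsymmxD hH hX).
set s := (fun i => _) in HXW; pose kap i := expR (s i).
have [U uU XU] := spectral_decomposition hX.
set x := (fun i => _) in XU.
have scalE (V' : 'M[R[i]]_n) : V' \is unitarymx ->
    specmx V' (fun=> c) = c%:C *: 1%:M.
  move=> uV'; rewrite -(specmx1 uV') specmxZ.
  by apply: eq_specmx => i; rewrite mulr1.
have XcE : X + c%:C *: 1%:M = specmx U (fun i => x i + c).
  by rewrite -(scalE _ uU) {1}XU; exact: specmxD.
have hXc : X + c%:C *: 1%:M \is hermsymmx by rewrite XcE specmx_herm.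
have tXc : trexp (X + c%:C *: 1%:M) = expR c * trexp X.
  rewrite XcE (trexp_specmx _ uU) XU (trexp_specmx _ uU) mulr_sumr.
  by apply: eq_bigr => i _; rewrite expRD mulrC.
have kap0 j : 0 <= kap j by exact: expR_ge0.
have := gibbs_trexp uW hXc kap0.
rewrite tXc -/(rtr _ _) HXW trexp_specmx //; move=> /le_trans; apply.
rewrite -addrA gerDl subr_le0.
have -> : \sum_j kap j * ln (kap j) = rtr (H + X) (specmx W kap).
  rewrite HXW /rtr (specmxM uW) (mxtrace_specmx uW).
  by apply: eq_bigr => j _; rewrite /kap expRK mulrC.
(* What remains is [tr H Y <= c tr Y], which holds overlap by overlap because every [h i] is at most
   [c]. *)
rewrite addrC !rtrDl lerD2l -(scalE _ uV) HV.
rewrite (rtr_specmxM V W h) (rtr_specmxM V W (fun=> c)).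
apply: ler_sum => i _; apply: ler_sum => j _; rewrite ler_wpM2r ?nsq_ge0 //.
rewrite ler_wpM2r //; apply: (le_trans (ler_norm _)).
by rewrite /c (bigD1 i) //= lerDl sumr_ge0.
Qed.

Lemma integrable_expmx_shift (n : nat) (X : T -> 'M[R[i]]_n) (H : 'M[R[i]]_n) :
  (forall w, X w \is hermsymmx) -> measurable_mx X -> H \is hermsymmx ->
  integrable_mx P (fun w => expmx (X w)) ->
  integrable_mx P (fun w => expmx (H + X w)).
Proof.
move=> hX mX hH iX; have [c c0 hc] := trexp_shift_le hH.
have hHX w : H + X w \is hermsymmx by exact: hermsymmxD hH (hX w).
have mHX : measurable_mx (fun w => H + X w).
  by apply: measurable_mxD => //; exact: measurable_mx_cst.
have iT : P.-integrable [set: T] (EFin \o (fun w => c * trexp (X w))).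
  rewrite /comp; under eq_fun do rewrite EFinM; apply: integrableZl => //.
  have := integrable_rtr 1%:M iX; rewrite /rtr /comp.
  by under eq_fun do rewrite mul1mx.
have dom (f : T -> R) : measurable_fun [set: T] f ->
    (forall w, `|f w| <= trexp (H + X w)) ->
    P.-integrable [set: T] (EFin \o f).
  move=> mf hf; apply: le_integrable iT => //; first exact/measurable_EFinP.
  move=> w _ /=; rewrite lee_fin [leRHS](ger0_norm (mulr_ge0 c0 (trexp_ge0 (hX w)))).
  exact: le_trans (hf w) (hc _ (hX w)).
move=> i j; have [mRe mIm] := measurable_expmx hHX mHX i j.
by split; apply: dom => // w; have [] := expmx_entry_le i j (hHX w).
Qed.

(** [kap j] is the quadratic form of the expectation at its [j]-th eigenvector, hence the integral
    of nonnegative quadratic forms. *)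
Lemma lambda_expectation_ge0 (n : nat) (Y : T -> 'M[R[i]]_n) (W : 'M[R[i]]_n)
    (kap : 'I_n -> R) : W \is unitarymx -> integrable_mx P Y ->
  (forall w x, 0 <= qform (Y w) x) ->
  expectation_mx P Y = specmx W kap -> forall j, 0 <= kap j.
Proof.
move=> uW iY Y0 YW j; pose x := W^t* *m delta_mx j 0 : 'cV_n.
have -> : kap j = qform (expectation_mx P Y) x.
  rewrite YW qform_specmx /x mulmxA (unitarymxP uW) mul1mx (bigD1 j) //=.
  rewrite !mxE !eqxx big1 => [|i /negbTE ij].
    by rewrite /nsq /= expr1n expr0n !addr0 mulr1.
  by rewrite !mxE ij /nsq /= expr0n addr0 mulr0.
rewrite qform_tr -/(rtr _ _) rtrC rtr_expectation //.
apply: Rintegral_ge0 => w _; rewrite rtrC /rtr -qform_tr; exact: Y0.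
Qed.

(** This is (Lieb-Tropp): the supporting functional sharp at the expectation of [Y] and [e^B] is
    averaged, then combined with Gibbs' principle at [H + B]. *)
Lemma jensen_trexp (n : nat) (X : T -> 'M[R[i]]_n) (H B : 'M[R[i]]_n) :
  (forall w, X w \is hermsymmx) -> measurable_mx X ->
  H \is hermsymmx -> B \is hermsymmx ->
  integrable_mx P (fun w => expmx (X w)) ->
  loewner_le (expectation_mx P (fun w => expmx (X w))) (expmx B) ->
  (\int[P]_w (trexp (H + X w))%:E <= (trexp (H + B))%:E)%E.
Proof.
move=> hX mX hH hB iX EXB.
have hHX w : H + X w \is hermsymmx by exact: hermsymmxD hH (hX w).
pose Y w := expmx (H + X w).
have iY : integrable_mx P Y by exact: integrable_expmx_shift.
have hM : expectation_mx P Y \is hermsymmx.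
  exact: expectation_mx_herm (fun w => hermsymmx_expmx (hHX w)) iY.
have [W uW MW] := spectral_decomposition hM.
set kap := (fun i => _) in MW.
have kap0 j : 0 <= kap j.
  move: j; refine (lambda_expectation_ge0 uW iY _ MW) => w x.
  have [U uU e] := spectral_decomposition (hHX w).
  rewrite /Y e expmx_specmx // qform_specmx; apply: sumr_ge0 => i _.
  by rewrite mulr_ge0 ?expR_ge0 ?nsq_ge0.
have trM : (\int[P]_w (trexp (H + X w))%:E = (\sum_j kap j)%:E)%E.
  have -> : \sum_j kap j = rtr 1%:M (expectation_mx P Y).
    by rewrite /rtr mul1mx MW mxtrace_specmx.
  rewrite (rtr_expectation _ iY) fineK; last first.
    exact: (integrable_fin_num measurableT (integrable_rtr _ iY)).
  by apply: eq_integral => w _; rewrite /rtr mul1mx.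
rewrite trM lee_fin; apply/ler_addgt0Pr => eps eps0.
have [C [G [CG G0 hyp]]] := supporting_hyperplane uW hB kap0 eps0.
have gibbs := gibbs_trexp uW (hermsymmxD hH hB) kap0.
rewrite -/(rtr _ _) -MW rtrDl in gibbs; rewrite -MW in hyp.
(* Positivity of [G] is what lets the semidefinite hypothesis on the expectation of [e^X] enter. *)
have GB : rtr G (expectation_mx P (fun w => expmx (X w))) <= rtr G (expmx B).
  have := G0 _ EXB; rewrite rtrC rtrBl !(rtrC _ G) subr_ge0; exact.
(* Pointwise, the functional at [(e^(H + X), e^X)] is at most [tr H Y], because the difference of
   the exponents is [H]. Both sides are linear and can be integrated. *)
have : rtr C (expectation_mx P Y) -
    rtr G (expectation_mx P (fun w => expmx (X w))) <=
    rtr H (expectation_mx P Y).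
  have iC := integrable_rtr C iY; have iG := integrable_rtr G iX.
  have iH := integrable_rtr H iY.
  rewrite (rtr_expectation C iY) (rtr_expectation G iX) (rtr_expectation H iY).
  rewrite -(RintegralB measurableT iC iG).
  apply: (le_Rintegral measurableT _ iH).
    exact: (integrableB measurableT iC iG).
  move=> w _; have := CG _ _ (hHX w) (hX w).
  by rewrite rtr_addK.
move: gibbs hyp GB.
move: (rtr C (expectation_mx P Y)) (rtr G (expectation_mx P _)) (rtr G (expmx B)).
move: (rtr H (expectation_mx P Y)) (rtr B (expectation_mx P Y)) (trexp (H + B)).
move: (\sum_j kap j) (\sum_j kap j * ln (kap j)) => *; lra.
Qed.

End lieb_jensen.

(** * Independent sigma-algebras and iterated integrals *)

Section decoupling.
Context {R : realType} {d : measure_display} {T : measurableType d}.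
Variable P : probability T R.
Local Open Scope ereal_scope.

(** Both sides are finite measures in [A] that agree on a pi-system containing the whole space, so
    they agree on the sigma-algebra it generates. *)
Lemma sigma_independent_l (G : set (set T)) (B : set T) :
  G `<=` measurable -> setI_closed G -> G setT -> measurable B ->
  (forall A, G A -> P (A `&` B) = P A * P B) ->
  forall A, <<s G >> A -> P (A `&` B) = P A * P B.
Proof.
move=> Gm GI GT mB GB A GA.
have PB0 : (0 <= fine (P B))%R by exact: fine_ge0.
have PBE : P B = (fine (P B))%:E by rewrite fineK // fin_num_measure.
have scaleE C : mscale (NngNum PB0) P C = P C * P B by rewrite /mscale /= -PBE muleC.
rewrite -scaleE -/(mrestr P mB A).
apply: (@g_sigma_algebra_measure_unique _ R T G Gm (fun=> setT)) => //.
- by apply/seteqP; split=> // x _; exists 0%N.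
- by move=> C GC; exact: etrans (GB _ GC) (esym (scaleE C)).
- move=> _; rewrite -[ltLHS]/(P (setT `&` B)) setTI.
  by rewrite (le_lt_trans (probability_le1 P mB)) // ltry.
Qed.

Lemma sigma_independent (G1 G2 : set (set T)) :
  G1 `<=` measurable -> G2 `<=` measurable ->
  setI_closed G1 -> setI_closed G2 -> G1 setT -> G2 setT ->
  (forall A B, G1 A -> G2 B -> P (A `&` B) = P A * P B) ->
  forall A B, <<s G1 >> A -> <<s G2 >> B -> P (A `&` B) = P A * P B.
Proof.
move=> G1m G2m G1I G2I G1T G2T ind A B GA GB.
have sub1 : <<s G1 >> `<=` measurable.
  by apply: smallest_sub => //; exact: sigma_algebra_measurable.
rewrite setIC muleC; apply: (sigma_independent_l G2m G2I G2T (sub1 _ GA)) => // B' GB'.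
rewrite setIC muleC; apply: (sigma_independent_l G1m G1I G1T (G2m _ GB')) => // A' GA'.
exact: ind.
Qed.

Lemma measurable_id_sigma (G : set (set T)) : G `<=` measurable ->
  measurable_fun [set: T] (id : T -> g_sigma_algebraType G).
Proof.
move=> Gm _ A GA; rewrite setTI preimage_id.
by move: A GA; apply: smallest_sub => //; exact: sigma_algebra_measurable.
Qed.

Lemma measurable_decouple (G1 G2 : set (set T))
    (F : g_sigma_algebraType G1 * g_sigma_algebraType G2 -> \bar R) :
  G1 `<=` measurable -> G2 `<=` measurable ->
  measurable_fun setT F -> (forall x, 0 <= F x) ->
  measurable_fun [set: T] (fun w => \int[P]_w' F (w, w')).
Proof.
move=> G1m G2m mF F0.
have mF' : measurable_fun setT (fun z : T * T => F (z.1, z.2)).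
  apply: (measurableT_comp mF); apply: measurable_fun_pair.
    exact: (measurableT_comp (measurable_id_sigma G1m) (@measurable_fst _ _ _ _)).
  exact: (measurableT_comp (measurable_id_sigma G2m) (@measurable_snd _ _ _ _)).
exact: (measurable_fun_fubini_tonelli_F (m2 := P) _ mF' (fun z => F0 (z.1, z.2))).
Qed.

(** Independence says that the diagonal map [w -> (w, w)], into the product of the two
    sub-sigma-algebras, carries [P] to a product measure. Tonelli's theorem then separates the
    variables. *)
Lemma integral_decouple (G1 G2 : set (set T))
    (F : g_sigma_algebraType G1 * g_sigma_algebraType G2 -> \bar R) :
  G1 `<=` measurable -> G2 `<=` measurable ->
  setI_closed G1 -> setI_closed G2 -> G1 setT -> G2 setT ->
  (forall A B, G1 A -> G2 B -> P (A `&` B) = P A * P B) ->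
  measurable_fun setT F -> (forall x, 0 <= F x) ->
  \int[P]_w F (w, w) = \int[P]_w \int[P]_w' F (w, w').
Proof.
move=> G1m G2m G1I G2I G1T G2T ind mF F0.
have id1 : measurable_fun [set: T] (id : T -> g_sigma_algebraType G1).
  exact: measurable_id_sigma.
have id2 : measurable_fun [set: T] (id : T -> g_sigma_algebraType G2).
  exact: measurable_id_sigma.
have diag : measurable_fun [set: T]
    (fun w => (w, w) : g_sigma_algebraType G1 * g_sigma_algebraType G2).
  exact: measurable_fun_pair.
pose X1 : {mfun T >-> g_sigma_algebraType G1} :=
  HB.pack (id : T -> g_sigma_algebraType G1) (isMeasurableFun.Build _ _ _ _ _ id1).
pose X2 : {mfun T >-> g_sigma_algebraType G2} :=
  HB.pack (id : T -> g_sigma_algebraType G2) (isMeasurableFun.Build _ _ _ _ _ id2).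
pose X12 : {mfun T >-> (g_sigma_algebraType G1 * g_sigma_algebraType G2)%type} :=
  HB.pack (fun w : T => (w, w) : g_sigma_algebraType G1 * g_sigma_algebraType G2)
    (isMeasurableFun.Build _ _ _ _ _ diag).
have joint A : measurable A ->
    (distribution P X1 \x distribution P X2) A = distribution P X12 A.
  apply: product_measure_unique => A' B' mA' mB'.
  by apply: sigma_independent mA' mB'.
transitivity (\int[distribution P X12]_z F z).
  by rewrite [RHS]ge0_integral_pushforward.
transitivity (\int[distribution P X1 \x distribution P X2]_z F z).
  by apply: eq_measure_integral => A mA _; exact/esym/joint.
rewrite fubini_tonelli1 //.
rewrite [LHS]ge0_integral_pushforward //; last 2 first.
  exact: measurable_fun_fubini_tonelli_F.
  by move=> x _; exact: integral_ge0.
apply: eq_integral => w _; rewrite /fubini_F /= [LHS]ge0_integral_pushforward //.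
exact: measurable_fun_pair2.
Qed.

End decoupling.

Section measurable_mx_borel.
Context {R : realType} {d : measure_display} {T : measurableType d}.

Lemma borel_mx_measurable (n : nat) (X : T -> 'M[R[i]]_n) :
  (forall B, borel_mx B -> measurable (X @^-1` B)) -> measurable_mx X.
Proof.
move=> mX i j; split=> _ B mB; rewrite setTI.
  rewrite (_ : _ @^-1` B = X @^-1` [set M | B (complex.Re (M i j))]) //.
  by apply: mX; apply: sub_sigma_algebra => /=; exists i, j, B; split=> //; left.
rewrite (_ : _ @^-1` B = X @^-1` [set M | B (complex.Im (M i j))]) //.
by apply: mX; apply: sub_sigma_algebra => /=; exists i, j, B; split=> //; right.
Qed.

Lemma measurable_mx_comp d' (T' : measurableType d') (m n : nat) (f : T' -> T)
    (F : T -> 'M[R[i]]_(m, n)) :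
  measurable_fun setT f -> measurable_mx F -> measurable_mx (F \o f).
Proof.
move=> mf mF i j; have [mRe mIm] := mF i j.
by split; [exact: (measurableT_comp mRe mf)|exact: (measurableT_comp mIm mf)].
Qed.

End measurable_mx_borel.

(** * Iterating over independent summands *)

Section independent_sums.
Context {R : realType} {d : measure_display} {T : measurableType d}.
Variable P : probability T R.
Variables (n m N : nat) (X : 'I_N -> T -> 'M[R[i]]_n).
Hypotheses (X_rand : forall j, random_mx (X j))
  (X_sa : forall j w, X j w \is hermsymmx) (X_indep : independent_mx P X).

(** A pi-system generating the sigma-algebra of the family [X j] for [j] in [J]. *)
Definition cylinders (J : {set 'I_N}) : set (set T) :=
  [set C | exists2 B : 'I_N -> set 'M[R[i]]_n, (forall j, borel_mx (B j)) &
     C = \bigcap_(j in [set` J]) (X j @^-1` B j)].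

Lemma borel_mxT : borel_mx [set: 'M[R[i]]_n].
Proof. by rewrite -setC0 -setTD; apply: sigma_algebraCD; exact: sigma_algebra0. Qed.

Lemma borel_mxI (A B : set 'M[R[i]]_n) :
  borel_mx A -> borel_mx B -> borel_mx (A `&` B).
Proof.
move=> bA bB.
rewrite -[A]setCK -[B]setCK -setCU -bigcup2E -setTD.
apply: sigma_algebraCD; apply: sigma_algebra_bigcup => -[|[|k]] /=.
- by rewrite -setTD; exact: sigma_algebraCD.
- by rewrite -setTD; exact: sigma_algebraCD.
- exact: sigma_algebra0.
Qed.

Lemma cylinders_measurable J : cylinders J `<=` measurable.
Proof.
move=> _ [B bB ->]; apply: fin_bigcap_measurable; first exact: finite_finset.
by move=> j _; apply: X_rand.
Qed.

Lemma cylinders_setI J : setI_closed (cylinders J).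
Proof.
move=> _ _ [A bA ->] [B bB ->]; exists (fun j => A j `&` B j).
  by move=> j; exact: borel_mxI.
by rewrite -bigcapI.
Qed.

Lemma cylinders_setT J : cylinders J setT.
Proof.
exists (fun=> setT) => [_|]; first exact: borel_mxT.
by apply/seteqP; split.
Qed.

Lemma cylinders_indep (J : {set 'I_N}) j A B : j \notin J ->
  cylinders J A -> cylinders [set j] B -> P (A `&` B) = (P A * P B)%E.
Proof.
move=> jJ [A' bA ->] [B' bB ->].
have Bset : \bigcap_(i in [set` [set j]%SET]) (X i @^-1` B' i) = X j @^-1` B' j.
  apply/seteqP; split=> w /=; first by apply; exact: set11.
  by move=> h i /set1P ->.
rewrite Bset.
(* Both events are merged into one family of Borel sets, and independence is applied to [j |: J] and
   again to [J]. *)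
pose C i := if i == j then B' j else A' i.
have bC i : borel_mx (C i) by rewrite /C; case: ifP.
have Cj : C j = B' j by rewrite /C eqxx.
have CJ i : i \in J -> C i = A' i.
  by rewrite /C; case: eqP => // ->; rewrite (negbTE jJ).
have := X_indep (j |: J)%SET bC; rewrite big_setU1 //= Cj muleC.
rewrite (eq_bigr (fun i => P (X i @^-1` A' i))) => [|i /CJ -> //].
rewrite -X_indep // => <-; congr (P _); apply/seteqP; split=> w /=.
  move=> [wA wB] i /=; rewrite !inE => /orP[/eqP ->|iJ]; first by rewrite Cj.
  by rewrite CJ //; exact: wA.
move=> h; split=> [i iJ|]; first by rewrite -(CJ i iJ); apply: h; rewrite /= !inE iJ orbT.
by rewrite -Cj; apply: h; rewrite /= !inE eqxx.
Qed.

Lemma cylinders_preimage (J : {set 'I_N}) j B : j \in J -> borel_mx B ->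
  cylinders J (X j @^-1` B).
Proof.
move=> jJ bB; exists (fun i => if i == j then B else setT).
  by move=> i; case: ifP => // _; exact: borel_mxT.
apply/seteqP; split=> w /=; last by move/(_ j jJ); rewrite /= eqxx.
by move=> h i _; case: eqP => [->|].
Qed.

Lemma measurable_mx_cylinders (J : {set 'I_N}) j : j \in J ->
  @measurable_mx R _ (g_sigma_algebraType (cylinders J)) n n (X j).
Proof.
move=> jJ; apply: borel_mx_measurable => B bB.
by apply: sub_sigma_algebra; exact: cylinders_preimage.
Qed.

Variables (V : 'M[R[i]]_(n, m)) (theta : R) (B : 'I_N -> 'M[R[i]]_m).
Let Z j w := theta%:C *: (V^t* *m X j w *m V).
Hypotheses (B_sa : forall j, B j \is hermsymmx)
  (Z_int : forall j, integrable_mx P (fun w => expmx (Z j w)))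
  (Z_le : forall j, loewner_le (expectation_mx P (fun w => expmx (Z j w))) (expmx (B j))).

Let Z_sa j w : Z j w \is hermsymmx.
Proof. exact: hermsymmxZ (hermsymmx_conj V (X_sa j w)). Qed.

Let Z_meas d' (T' : measurableType d') (Y : T' -> 'M[R[i]]_n) :
  measurable_mx Y -> measurable_mx (fun w => theta%:C *: (V^t* *m Y w *m V)).
Proof.
move=> mY; apply: measurable_mxZ.
by do !apply: measurable_mxM => //; exact: measurable_mx_cst.
Qed.

(** Induction on [s]: with the other summands frozen, [jensen_trexp] replaces [Z j] by [B j], which
    is then absorbed into [H]. This is why [H] is arbitrary. *)
Lemma trexp_sum_le (s : seq 'I_N) (H : 'M[R[i]]_m) : uniq s -> H \is hermsymmx ->
  (\int[P]_w (trexp (H + \sum_(j <- s) Z j w))%:E <=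
   (trexp (H + \sum_(j <- s) B j))%:E)%E.
Proof.
elim: s H => [|j s IHs] H.
  move=> _ hH; under eq_integral do rewrite big_nil.
  rewrite big_nil integral_cst // -[leRHS]mule1 lee_wpmul2l //.
    by rewrite lee_fin; apply: trexp_ge0 (hermsymmxD hH (hermsymmx0 _)).
  exact: probability_le1.
rewrite cons_uniq => /andP[js us] hH.
have hS w : \sum_(i <- s) Z i w \is hermsymmx.
  exact: hermsymmx_sum (fun i _ => Z_sa i w).
pose J : {set 'I_N} := [set i | i \in s]%SET.
have jJ : j \notin J by rewrite inE.
pose G1 := cylinders J; pose G2 := cylinders [set j]%SET.
(* The first variable drives the summands in [s] and the second drives [Z j]; the original integrand
   is [F] on the diagonal. *)
pose F (z : g_sigma_algebraType G1 * g_sigma_algebraType G2) :=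
  (trexp ((H + \sum_(i <- s) Z i z.1) + Z j z.2))%:E.
have hF w w' : (H + \sum_(i <- s) Z i w) + Z j w' \is hermsymmx.
  exact: hermsymmxD (hermsymmxD hH (hS w)) (Z_sa j w').
have mF : measurable_fun setT F.
  apply/measurable_EFinP; apply: measurable_trexp; first by move=> z; exact: hF.
  apply: measurable_mxD; last first.
    have mj := measurable_mx_cylinders (set11 j).
    exact: (measurable_mx_comp (@measurable_snd _ _ _ _) (Z_meas mj)).
  apply: measurable_mxD; first exact: measurable_mx_cst.
  (* Measurability for [cylinders J] is available only for indices in [J]; the other terms, which
     never occur in the sum over [s], are replaced by 0. *)
  rewrite (_ : (fun z => _) =
      (fun w => \sum_(i <- s) (if i \in J then Z i w else 0)) \o fst).
    apply: (measurable_mx_comp (@measurable_fst _ _ _ _)).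
    apply: measurable_mx_sum => i _; case: (boolP (i \in J)) => iJ.
      exact: Z_meas (measurable_mx_cylinders iJ).
    exact: measurable_mx_cst.
  apply/funext => z /=; rewrite !big_seq; apply: eq_bigr => i si.
  by rewrite inE si.
have F0 z : (0 <= F z)%E by rewrite lee_fin; exact: trexp_ge0 (hF _ _).
have hHBS w : (H + B j) + \sum_(i <- s) Z i w \is hermsymmx.
  exact: hermsymmxD (hermsymmxD hH (B_sa j)) (hS w).
have -> : (\int[P]_w (trexp (H + \sum_(i <- j :: s) Z i w))%:E = \int[P]_w F (w, w))%E.
  apply: eq_integral => w _; rewrite big_cons /F /=.
  by rewrite [Z j w + _]addrC addrA.
rewrite (integral_decouple (@cylinders_measurable _) (@cylinders_measurable _)
  (@cylinders_setI _) (@cylinders_setI _) (cylinders_setT _) (cylinders_setT _)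
  (fun A C => @cylinders_indep J j A C jJ) mF F0).
have mX i : measurable_mx (X i) by apply: borel_mx_measurable => C; exact: X_rand.
apply: (@le_trans _ _ (\int[P]_w (trexp ((H + B j) + \sum_(i <- s) Z i w))%:E)%E).
  apply: (ge0_le_integral P measurableT).
  - by move=> w _; apply: integral_ge0 => w' _; exact: F0.
  - exact: (measurable_decouple P (@cylinders_measurable _)
      (@cylinders_measurable _) mF F0).
  - apply/measurable_EFinP; apply: (measurable_trexp hHBS).
    apply: measurable_mxD; first exact: measurable_mx_cst.
    by apply: measurable_mx_sum => i _; exact: Z_meas (mX i).
  move=> w _; rewrite [H + B j + _]addrAC.
  exact: jensen_trexp (Z_sa j) (Z_meas (mX j)) (hermsymmxD hH (hS w)) (B_sa j)
    (Z_int j) (Z_le j).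
rewrite big_cons addrA; exact: IHs us (hermsymmxD hH (B_sa j)).
Qed.

Lemma trexp_sum_le_eq (H Bs : 'M[R[i]]_m) (Zs : T -> 'M[R[i]]_m) :
  H \is hermsymmx -> (forall w, H + \sum_(j < N) Z j w = Zs w) ->
  H + \sum_(j < N) B j = Bs ->
  (\int[P]_w (trexp (Zs w))%:E <= (trexp Bs)%:E)%E.
Proof.
move=> hH ZsE <-.
rewrite (eq_integral (fun w => (trexp (H + \sum_(j < N) Z j w))%:E)) => [|w _].
  exact: (trexp_sum_le (index_enum_uniq _) hH).
by rewrite -(ZsE w).
Qed.

End independent_sums.

(** * Measurability of the tail event *)

Section measurable_lambda.
Context {R : realType} {d : measure_display} {T : measurableType d}.

(** The inner exponential tends to 0 when [x >= t] and to infinity when [x < t]. The extra [- M]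
    settles the boundary case [x = t], and [e^(-z) <= 1 / (1 + z)] gives explicit harmonic
    bounds. *)
Lemma cvg_smooth_step (t x : R) :
  (fun M : nat => expR (- expR (- M%:R ^+ 2 * (x - t) - M%:R))) @ \oo -->
  ((t <= x)%R%:R : R).
Proof.
have expN_le (z : R) : 0 <= z -> expR (- z) <= (1 + z)^-1.
  by move=> z0; rewrite expRN lef_pV2 ?posrE ?expR_gt0 ?expR_ge1Dx // ltr_pwDl.
have harmE M : (1 + M%:R)^-1 = @harmonic R M by rewrite /harmonic /= -natr1 addrC.
have [tx|xt] := leP t x.
  have harm1 : (fun M : nat => 1 - @harmonic R M) @ \oo --> (1 : R).
    rewrite -[X in _ --> X]subr0.
    by apply: cvgB; [exact: cvg_cst|exact: cvg_harmonic].
  apply: (squeeze_cvgr _ harm1 (cvg_cst (1 : R))); near=> M.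
  rewrite -[X in _ && (_ <= X)](expR0) ler_expR oppr_le0 expR_ge0 andbT.
  apply: le_trans (expR_ge1Dx _); rewrite lerD2l lerN2 -harmE.
  apply: le_trans (expN_le _ (ler0n _ _)); rewrite ler_expR gerDr mulNr oppr_le0.
  by rewrite mulr_ge0 ?sqr_ge0 // subr_ge0.
apply: (squeeze_cvgr _ (cvg_cst (0 : R)) (@cvg_harmonic R)); near=> M.
rewrite expR_ge0 andTb -harmE; apply: le_trans (expN_le _ (expR_ge0 _)) _.
rewrite lef_pV2 ?posrE ?ltr_pwDl ?expR_ge0 // lerD2l.
(* Once [M (t - x) >= 2], the inner exponent is at least [M]. *)
apply: le_trans (expR_ge1Dx _); have M0 : 0 <= M%:R :> R by exact: ler0n.
have : 2 <= M%:R * (t - x).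
  by rewrite -ler_pdivrMr ?subr_gt0 //; near: M; exact: nbhs_infty_ger.
by move=> /(ler_wpM2l M0); lra.
Unshelve. all: by end_near.
Qed.

(** The eigenvalues are sorted, so those that are at least [t] form an initial segment. The count is
    symmetric in the eigenvalues and hence accessible through traces. *)
Lemma lambda_ge_count (n k : nat) (A : 'M[R[i]]_n) (t : R) :
  A \is hermsymmx -> (1 <= k)%N -> (k <= n)%N ->
  (t <= lambda k A) = (k%:R <= \sum_(i < n) (t <= lambda i.+1 A)%R%:R :> R).
Proof.
case: k => // k hA _ kn.
have sumE p : (p <= n)%N -> \sum_(i < n) (i < p)%N%:R = p%:R :> R.
  move=> pn; rewrite (eq_bigr (fun i : 'I_n => if (i < p)%N then 1 else 0)); last first.
    by move=> i _; case: ifP.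
  by rewrite -big_mkcond /= (big_ord_narrow pn) /= sumr_const card_ord.
apply/idP/idP => [tk|].
  rewrite -sumE //; apply: ler_sum => i _; case: ltnP => // ik.
  by rewrite (le_trans tk) // lambda_le.
apply: contraLR; rewrite -!ltNge => kt.
apply: (@le_lt_trans _ _ k%:R); last by rewrite ltr_nat.
rewrite -sumE; last exact: ltnW.
apply: ler_sum => i _; case: ltnP => [_|ki]; first by rewrite ler_nat leq_b1.
by rewrite lern0 eqb0 -ltNge (le_lt_trans _ kt) // lambda_le.
Qed.

(* The number of eigenvalues that are at least t is the limit of
   tr exp (- exp (- M^2 (Y - t) - M)) as M tends to infinity. *)
Lemma measurable_lambda_ge (n k : nat) (Y : T -> 'M[R[i]]_n) (t : R) :
  (forall w, Y w \is hermsymmx) -> measurable_mx Y ->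
  (1 <= k)%N -> (k <= n)%N ->
  measurable [set w | (t <= lambda k (Y w))%R].
Proof.
move=> hY mY k1 kn.
pose S (M : nat) w : 'M[R[i]]_n :=
  (- M%:R ^+ 2)%:C *: Y w + (M%:R ^+ 2 * t - M%:R)%:C *: 1%:M.
have SE M w (U : 'M[R[i]]_n) : U \is unitarymx ->
    Y w = specmx U (fun i => lambda i.+1 (Y w)) ->
    S M w = specmx U (fun i => - M%:R ^+ 2 * (lambda i.+1 (Y w) - t) - M%:R).
  move=> uU YU; rewrite /S {1}YU -(specmx1 uU) !specmxZ specmxD.
  by apply: eq_specmx => i; ring.
have hS M w : S M w \is hermsymmx.
  have [U uU YU] := spectral_decomposition (hY w).
  by rewrite (SE M w U uU YU) specmx_herm.
have hE M w : (-1)%:C *: expmx (S M w) \is hermsymmx.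
  exact: hermsymmxZ (hermsymmx_expmx (hS M w)).
have mS M : measurable_mx (S M).
  by apply: measurable_mxD; [exact: measurable_mxZ|exact: measurable_mx_cst].
have mE M : measurable_fun [set: T] (fun w => trexp ((-1)%:C *: expmx (S M w))).
  exact: measurable_trexp (hE M) (measurable_mxZ _ (measurable_expmx (hS M) (mS M))).
have mC : measurable_fun [set: T]
    (fun w => \sum_(i < n) (t <= lambda i.+1 (Y w))%R%:R : R).
  apply: (measurable_fun_cvg mE) => w _.
  have [U uU YU] := spectral_decomposition (hY w).
  under eq_fun do rewrite (SE _ w U uU YU) expmx_specmx // specmxZ trexp_specmx //.
  apply: cvgn_sum => i; under eq_fun do rewrite mulN1r.
  exact: cvg_smooth_step.
rewrite (_ : mkset _ =
    (fun w => \sum_(i < n) (t <= lambda i.+1 (Y w))%R%:R : R) @^-1` `[k%:R, +oo[).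
  by rewrite -[X in measurable X]setTI; exact: mC.
by apply/seteqP; split=> w /=; rewrite in_itv /= andbT -lambda_ge_count.
Qed.

End measurable_lambda.
(** * Tail bounds *)

Section compressions.
Context {R : realType}.

(** The sum runs over the [m] smallest eigenvalues when [m <= n]. It is the minimum of the trace
    exponential over compressions of a self-adjoint matrix to dimension [m]. *)
Definition bottom_trexp (n m : nat) (A : 'M[R[i]]_n) : R :=
  \sum_(j < m) expR (lambda (j + (n - m)).+1 A).

Lemma bottom_trexp_le (n m : nat) (A : 'M[R[i]]_n) (V : 'M[R[i]]_(n, m)) :
  A \is hermsymmx -> stiefel V -> (m <= n)%N ->
  bottom_trexp m A <= trexp (V^t* *m A *m V).
Proof.
move=> hA hV mn; rewrite /trexp trexpE ?hermsymmx_conj //.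
by apply: ler_sum => j _; rewrite ler_expR poincare_separation.
Qed.

Lemma bottom_trexp_attained (n m : nat) (A : 'M[R[i]]_n) :
  A \is hermsymmx -> (m <= n)%N ->
  exists2 V : 'M[R[i]]_(n, m), stiefel V &
    trexp (V^t* *m A *m V) = bottom_trexp m A.
Proof.
move=> hA mn; have [U uU AU] := spectral_decomposition hA.
have fP (j : 'I_m) : (j + (n - m) < n)%N by have := ltn_ord j; lia.
pose f (j : 'I_m) := Ordinal (fP j).
have f_inj : injective f by move=> i j /(congr1 val) /= /addIn /val_inj.
(* [S] selects the last [m] coordinates, so the columns of [U^t* *m S] are the eigenvectors of the
   [m] smallest eigenvalues. *)
pose S : 'M[R[i]]_(n, m) := \matrix_(i, j) (i == f j)%:R.
have SC : S^t* = \matrix_(j, i) (i == f j)%:R.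
  by apply/matrixP => j i; rewrite !mxE; case: eqP => _; rewrite ?rmorph1 ?rmorph0.
have SDS (D : 'rV[R[i]]_n) : S^t* *m diag_mx D *m S = diag_mx (\row_j D 0 (f j)).
  rewrite SC mul_mx_diag; apply/matrixP => i j; rewrite !mxE (bigD1 (f j)) //=.
  rewrite big1 => [|l /negbTE lj]; last by rewrite !mxE lj mulr0.
  rewrite !mxE eqxx mulr1 addr0 (inj_eq f_inj) eq_sym.
  by case: eqP => [->|_]; rewrite ?mul1r ?mul0r.
have SS : S^t* *m S = 1%:M.
  have := SDS (const_mx 1); rewrite diag_const_mx mulmx1 => ->.
  by rewrite -diag_const_mx; congr diag_mx; apply/rowP => j; rewrite !mxE.
have u1 : (1%:M : 'M[R[i]]_m) \is unitarymx.
  by apply/unitarymxP; rewrite trmxC1 mulmx1.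
exists (U^t* *m S).
  rewrite /stiefel /= trmxC_mul trmxCK -mulmxA (mulmxA U) (unitarymxP uU).
  by rewrite mul1mx.
rewrite (_ : _ *m _ = specmx 1%:M (fun j : 'I_m => lambda (j + (n - m)).+1 A)).
  by rewrite trexp_specmx.
rewrite {1}AU /specmx trmxC1 mul1mx mulmx1 trmxC_mul trmxCK !mulmxA.
rewrite -[S^t* *m U *m U^t*]mulmxA (unitarymxP uU) mulmx1.
rewrite -[_ *m U *m U^t*]mulmxA (unitarymxP uU) mulmx1 SDS.
by congr diag_mx; apply/rowP => j; rewrite !mxE.
Qed.

(** The penalty shares the eigenbasis [U], so it only lowers the first [p] exponents by [c]. *)
Lemma trexp_penalized (n p : nat) (U : 'M[R[i]]_n) (a : nat -> R) (c : R) :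
  U \is unitarymx -> (p <= n)%N ->
  trexp (specmx U (fun i => if (i < p)%N then - c else 0) + specmx U (fun i => a i)) =
  expR (- c) * (\sum_(i < p) expR (a i)) + \sum_(j < n - p) expR (a (j + p)%N).
Proof.
move=> uU pn; rewrite specmxD trexp_specmx //.
rewrite -(big_mkord xpredT (fun i => expR ((if (i < p)%N then - c else 0) + a i))).
rewrite (big_cat_nat (leq0n p) pn) /=; congr (_ + _).
  rewrite big_mkord mulr_sumr; apply: eq_bigr => i _.
  by rewrite ltn_ord expRD.
rewrite -{1}[p]add0n big_addn big_mkord; apply: eq_bigr => j _.
by rewrite ltnNge leq_addl /= add0r.
Qed.

(** The range of [V], of dimension [n - k + 1], meets the span of the top [k] eigenvectors of [Y].
    On a common vector the quadratic form of [Y] is at least [t] times the squared norm. *)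
Lemma expR_le_trexp_compression (n k : nat) (Y : 'M[R[i]]_n)
    (V : 'M[R[i]]_(n, n - k + 1)) (t theta : R) :
  (1 <= k)%N -> (k <= n)%N -> 0 < theta -> Y \is hermsymmx -> stiefel V ->
  t <= lambda k Y -> expR (theta * t) <= trexp (theta%:C *: (V^t* *m Y *m V)).
Proof.
move=> k1 kn theta0 hY hV tk; have [U uU YU] := spectral_decomposition hY.
have [||x x0 [_ Ux]] := @common_vector _ n (n - k + 1) 0 V 1%:M U.
- by rewrite addn1.
- by lia.
have k1n : (k.-1 < n)%N by lia.
have Ux' (i : 'I_n) : (k.-1 < i)%N -> (U *m (V *m x)) i 0 = 0.
  by move=> ki; apply: Ux; lia.
have := lambda_le_qform hY uU YU k1n Ux'; rewrite (prednK k1) => le_q.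
apply: (expR_le_trexp (hermsymmxZ _ (hermsymmx_conj V hY)) x0).
rewrite qformZ qform_conj -mulrA ler_wpM2l ?(ltW theta0) //.
apply: le_trans le_q; rewrite (sqnorm_isometry x hV).
by rewrite ler_wpM2r ?sqnorm_ge0.
Qed.

(** Some nonzero vector in the span of the top [k] eigenvectors of [Y] is orthogonal to the [k - 1]
    penalized directions. The penalty vanishes there, so the bound is uniform in [c]. *)
Lemma expR_le_trexp_penalized (n k : nat) (Y U : 'M[R[i]]_n) (c t theta : R) :
  (1 <= k)%N -> (k <= n)%N -> 0 < theta -> Y \is hermsymmx -> U \is unitarymx ->
  t <= lambda k Y ->
  expR (theta * t) <=
    trexp (specmx U (fun i => if (i < k.-1)%N then - c else 0) + theta%:C *: Y).
Proof.
move=> k1 kn theta0 hY uU tk; have [W uW YW] := spectral_decomposition hY.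
have k1n : (k.-1 < n)%N by lia.
have [x x0 [Ux Wx]] := common_vector 1%:M U W k1n (leqnn n).
have Wx' (i : 'I_n) : (k.-1 < i)%N -> (W *m x) i 0 = 0.
  by move=> ki; have := Wx i; rewrite mul1mx; apply; lia.
have := lambda_le_qform hY uW YW k1n Wx'; rewrite (prednK k1) => le_q.
apply: (expR_le_trexp (hermsymmxD (specmx_herm _ _) (hermsymmxZ _ hY)) x0).
rewrite qformD qformZ qform_specmx big1 ?add0r => [|i _].
  rewrite -mulrA ler_wpM2l ?(ltW theta0) //; apply: le_trans le_q.
  by rewrite ler_wpM2r ?sqnorm_ge0.
by case: ifP => [/Ux ->|_]; rewrite ?mul0r // /nsq /= expr0n addr0 mulr0.
Qed.

End compressions.

Section markov.
Context {R : realType} {d : measure_display} {T : measurableType d}.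
Variable P : probability T R.

Lemma markov_expR (E : set T) (f : T -> R) (s b : R) :
  measurable E -> measurable_fun [set: T] f -> (forall w, 0 <= f w) ->
  (forall w, E w -> expR s <= f w) -> (\int[P]_w (f w)%:E <= b%:E)%E ->
  (P E <= (expR (- s) * b)%:E)%E.
Proof.
move=> mE mf f0 Ef fb.
have PE : P E = (fine (P E))%:E by rewrite fineK // fin_num_measure.
have : ((expR s)%:E * P E <= b%:E)%E.
  apply: le_trans fb; rewrite -[X in P X]setIT -integral_indic //.
  rewrite -ge0_integralZl //; last exact/measurable_EFinP/measurable_indic.
  apply: (ge0_le_integral P measurableT).
  - by move=> w _; rewrite -EFinM lee_fin mulr_ge0 ?expR_ge0.
  - by apply: measurable_funeM; exact/measurable_EFinP/measurable_indic.
  - exact/measurable_EFinP.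
  move=> w _; rewrite -EFinM lee_fin indicE; case: (boolP (w \in E)) => wE.
    by rewrite mulr1 Ef // -in_setE.
  by rewrite mulr0.
by rewrite PE -EFinM !lee_fin expRN ler_pdivlMl ?expR_gt0.
Qed.

End markov.

(** * The two tail bounds for a fixed parameter [theta] *)

Section tail_bounds.
Context {R : realType} {d : measure_display} {T : measurableType d}.
Variables (P : probability T R) (n N k : nat) (X : 'I_N -> T -> 'M[R[i]]_n).
Hypotheses (hk1 : (1 <= k)%N) (hkn : (k <= n)%N)
  (X_rand : forall j, random_mx (X j))
  (X_sa : forall j w, X j w \is hermsymmx) (X_indep : independent_mx P X).

Let Xsum w := \sum_(j < N) X j w.

Let Xsum_sa w : Xsum w \is hermsymmx.
Proof. exact: hermsymmx_sum (fun j _ => X_sa j w). Qed.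

Let Xsum_meas : measurable_mx Xsum.
Proof.
apply: measurable_mx_sum => j _; apply: borel_mx_measurable => B.
exact: X_rand.
Qed.

Lemma conj_sum (m : nat) (V : 'M[R[i]]_(n, m)) (A : 'I_N -> 'M[R[i]]_n) :
  \sum_(j < N) (V^t* *m A j *m V) = V^t* *m (\sum_(j < N) A j) *m V.
Proof. by rewrite mulmx_sumr mulmx_suml. Qed.

Lemma measurable_tail t : measurable [set w | (t <= lambda k (Xsum w))%R].
Proof. exact: measurable_lambda_ge. Qed.

Lemma tail_compression (V : 'M[R[i]]_(n, n - k + 1))
    (B : 'I_N -> 'M[R[i]]_(n - k + 1)) (theta t : R) :
  0 < theta -> stiefel V -> (forall j, B j \is hermsymmx) ->
  (forall j, integrable_mx P (fun w => expmx (theta%:C *: (V^t* *m X j w *m V))) /\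
     loewner_le
       (expectation_mx P (fun w => expmx (theta%:C *: (V^t* *m X j w *m V))))
       (expmx (B j))) ->
  (P [set w | (t <= lambda k (Xsum w))%R] <=
   (expR (- (theta * t)) * trexp (\sum_(j < N) B j))%:E)%E.
Proof.
move=> theta0 hV hB hZ.
have hc w : theta%:C *: (V^t* *m Xsum w *m V) \is hermsymmx.
  exact: hermsymmxZ (hermsymmx_conj V (Xsum_sa w)).
apply: (@markov_expR _ _ _ P _ (fun w => trexp (theta%:C *: (V^t* *m Xsum w *m V)))).
- exact: measurable_tail.
- apply: (measurable_trexp hc); apply: measurable_mxZ.
  apply: measurable_mxM; last exact: measurable_mx_cst.
  by apply: measurable_mxM; first exact: measurable_mx_cst.
- by move=> w; exact: trexp_ge0 (hc w).
- move=> w tw; exact: expR_le_trexp_compression.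
apply: (trexp_sum_le_eq X_rand X_sa X_indep hB (fun j => (hZ j).1)
  (fun j => (hZ j).2) (hermsymmx0 _)) => [w|]; last exact: add0r.
by rewrite add0r -scaler_sumr conj_sum.
Qed.

(** The argument stays in dimension [n]: the initial matrix [H c] penalizes the top [k - 1]
    eigenvectors of [S], and the excess [e^(-c) K] disappears as [c] grows. *)
Lemma tail_bottom (A : 'I_N -> 'M[R[i]]_n) (theta t : R) :
  0 < theta -> (forall j, A j \is hermsymmx) ->
  (forall j, integrable_mx P (fun w => expmx (theta%:C *: X j w)) /\
     loewner_le (expectation_mx P (fun w => expmx (theta%:C *: X j w)))
                (expmx (A j))) ->
  (P [set w | (t <= lambda k (Xsum w))%R] <=
   (expR (- (theta * t)) *
    bottom_trexp (n - k + 1) (\sum_(j < N) A j))%:E)%E.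
Proof.
move=> theta0 hA hZ; set S := \sum_(j < N) A j.
have hS : S \is hermsymmx by exact: hermsymmx_sum (fun j _ => hA j).
have [U uU SU] := spectral_decomposition hS.
pose H c := specmx U (fun i => if (i < k.-1)%N then - c else 0 : R).
have hH c : H c \is hermsymmx by exact: specmx_herm.
have hHX c w : H c + theta%:C *: Xsum w \is hermsymmx.
  exact: hermsymmxD (hH c) (hermsymmxZ _ (Xsum_sa w)).
pose K := expR (- (theta * t)) * \sum_(i < k.-1) expR (lambda i.+1 S).
have K0 : 0 <= K.
  by rewrite mulr_ge0 ?expR_ge0 //; apply: sumr_ge0 => i _; exact: expR_ge0.
have bound c : (P [set w | (t <= lambda k (Xsum w))%R] <=
    (expR (- (theta * t)) * bottom_trexp (n - k + 1) S + expR (- c) * K)%:E)%E.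
  have -> : expR (- (theta * t)) * bottom_trexp (n - k + 1) S + expR (- c) * K =
      expR (- (theta * t)) * trexp (H c + S).
    have k1n : (k.-1 <= n)%N by lia.
    rewrite {2}SU (trexp_penalized (fun i => lambda i.+1 S) c uU k1n).
    rewrite /K mulrDr mulrCA addrC; congr (_ + _ * _).
    rewrite /bottom_trexp (_ : (n - (n - k + 1))%N = k.-1); last by lia.
    by rewrite (_ : (n - k + 1)%N = (n - k.-1)%N) //; lia.
  apply: (@markov_expR _ _ _ P _ (fun w => trexp (H c + theta%:C *: Xsum w))).
  - exact: measurable_tail.
  - apply: (measurable_trexp (hHX c)); apply: measurable_mxD.
      exact: measurable_mx_cst.
    exact: measurable_mxZ.
  - by move=> w; exact: trexp_ge0 (hHX c w).
  - move=> w tw.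
    exact: (expR_le_trexp_penalized c hk1 hkn theta0 (Xsum_sa w) uU tw).
  (* The sum bound is stated for compressions, and is used here with [V] the identity. *)
  have one (Y : 'M[R[i]]_n) : (1%:M : 'M[R[i]]_n)^t* *m Y *m 1%:M = Y.
    by rewrite trmxC1 mul1mx mulmx1.
  have hZ1 j : integrable_mx P (fun w => expmx (theta%:C *: (1%:M^t* *m X j w *m 1%:M))).
    by under eq_fun do rewrite one; exact: (hZ j).1.
  have hZ2 j : loewner_le (expectation_mx P
      (fun w => expmx (theta%:C *: (1%:M^t* *m X j w *m 1%:M)))) (expmx (A j)).
    by under eq_fun do rewrite one; exact: (hZ j).2.
  apply: (trexp_sum_le_eq X_rand X_sa X_indep hA hZ1 hZ2 (hH c)) => // w.
  by rewrite -scaler_sumr conj_sum one.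
have PE : P [set w | (t <= lambda k (Xsum w))%R] =
    (fine (P [set w | (t <= lambda k (Xsum w))%R]))%:E.
  by rewrite fineK // fin_num_measure //; exact: measurable_tail.
rewrite PE lee_fin; apply/ler_addgt0Pr => eps eps0.
(* With [c = K / eps], [c <= 1 + c <= e^c] gives [e^(-c) K <= eps]. *)
have := bound (K / eps); rewrite PE lee_fin => /le_trans; apply.
rewrite lerD2l expRN mulrC ler_pdivrMr ?expR_gt0 // mulrC.
rewrite -ler_pdivrMr //; apply: le_trans (expR_ge1Dx _).
by rewrite lerDr.
Qed.

End tail_bounds.

Theorem theorem3p3 (R : realType) (d : measure_display) (T : measurableType d)
  (P : probability T R) (n N k : nat) (X : 'I_N -> T -> 'M[R[i]]_n)
  (hk1 : (1 <= k)%N) (hkn : (k <= n)%N)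
  (X_rand : forall j, random_mx (X j))
  (X_sa : forall j w, X j w \is hermsymmx)
  (X_indep : independent_mx P X) :
  (forall (A : 'I_N -> 'M[R[i]]_n) (g : R -> R),
     (forall j, A j \is hermsymmx) ->
     (forall theta : R, 0 < theta -> 0 <= g theta) ->
     (forall j (theta : R), 0 < theta ->
        integrable_mx P (fun w => expmx (theta%:C *: X j w)) /\
        loewner_le (expectation_mx P (fun w => expmx (theta%:C *: X j w)))
                   (expmx ((g theta)%:C *: A j))) ->
     forall t : R,
       exists2 m : R -> R,
         (forall theta : R, 0 < theta ->
            is_minimum
              [set expR (- theta * t) *
                   complex.Re (\tr (expmx ((g theta)%:C *:
                     \sum_(j < N) (V^t* *m A j *m V))))
                 | V in @stiefel R n (n - k + 1)]
              (m theta)) &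
         (P [set w | (t <= lambda k (\sum_(j < N) X j w))%R]
          <= ereal_inf [set (m theta)%:E | theta in [set x : R | 0 < x]%R])%E)
  /\
  (forall (A : 'I_N -> 'M[R[i]]_(n, n - k + 1) -> 'M[R[i]]_(n - k + 1))
          (g : R -> R),
     (forall j V, stiefel V -> A j V \is hermsymmx) ->
     (forall theta : R, 0 < theta -> 0 <= g theta) ->
     (forall j (theta : R) V, 0 < theta -> stiefel V ->
        integrable_mx P (fun w => expmx (theta%:C *: (V^t* *m X j w *m V))) /\
        loewner_le
          (expectation_mx P
             (fun w => expmx (theta%:C *: (V^t* *m X j w *m V))))
          (expmx ((g theta)%:C *: A j V))) ->
     forall t : R,
       (P [set w | (t <= lambda k (\sum_(j < N) X j w))%R]
        <= ereal_inf
             [set ereal_inf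
                [set (expR (- theta * t) *
                      complex.Re (\tr (expmx ((g theta)%:C *:
                        \sum_(j < N) A j V))))%R%:E
                   | V in @stiefel R n (n - k + 1)]
                | theta in [set x : R | 0 < x]%R])%E).
Proof.
split=> A g hA g0 hZ t.
  pose S theta := (g theta)%:C *: \sum_(j < N) A j.
  have hS theta : S theta \is hermsymmx.
    exact: hermsymmxZ (hermsymmx_sum _ (fun j _ => hA j)).
  have m_le_n : (n - k + 1 <= n)%N by lia.
  have compE theta (V : 'M[R[i]]_(n, n - k + 1)) :
      (g theta)%:C *: \sum_(j < N) (V^t* *m A j *m V) = V^t* *m S theta *m V.
    by rewrite conj_sum /S -scalemxAr -scalemxAl.
  (* Poincare separation makes this value a lower bound over all [V], and the bottom eigenvectors of
     [S theta] attain it. *)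
  exists (fun theta => expR (- theta * t) * bottom_trexp (n - k + 1) (S theta)).
    move=> theta theta0; split.
      have [V hV e] := bottom_trexp_attained (hS theta) m_le_n.
      by exists V => //; rewrite compE -/(trexp _) e.
    move=> _ [V hV <-]; rewrite compE -/(trexp _) ler_wpM2l ?expR_ge0 //.
    exact: bottom_trexp_le.
  apply: le_ereal_inf_tmp => _ [theta theta0 <-]; rewrite mulNr /S scaler_sumr.
  apply: (tail_bottom hk1 hkn X_rand X_sa X_indep t theta0) => j.
    exact: hermsymmxZ (hA j).
  exact: hZ.
apply: le_ereal_inf_tmp => _ [theta theta0 <-].
apply: le_ereal_inf_tmp => _ [V hV <-]; rewrite mulNr -/(trexp _) scaler_sumr.
apply: (tail_compression hk1 hkn X_rand X_sa X_indep t theta0 hV) => j.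
  exact: hermsymmxZ (hA j V hV).
exact: hZ.
Qed.
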